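(* Let $J$ be a nonnegative, compactly supported, symmetric kernel on $\mathbb{R}$ with $\int_{\mathbb{R}}J=1$, and let $f(\cdot;q)$ satisfy the monostable condition: $f(\cdot;q)\in C^2([0,1])$, $f(0;q)=f(1;q)=0$, $f'(0;q)>0>f'(1;q)$, and $f(w;q)>0$ for all $w\in(0,1)$. Let $c_{NL}^*(q)$ be the minimal traveling wave speed of $w_t=J\ast w-w+f(w;q)$, let $\mathcal{W}_q$ be the minimal traveling wave (the traveling wave with speed $c=c_{NL}^*(q)$), and let $c_0^*:=\min_{\lambda>0}h(\lambda)/\lambda$, where $h(\lambda)=\int_{\mathbb{R}}J(z)e^{\lambda z}\,dz-1+f'(0;q)$, and let $\lambda_0>0$ be the unique positive number with $h(\lambda_0)=c_0^*\lambda_0$. Assume that $c_{NL}^*(q)=c_0^*$. Then $$\mathcal{W}_q(\xi)=A\xi e^{-\lambda_0\xi}+Be^{-\lambda_0\xi}+o(e^{-\lambda_0\xi})\quad\text{as }\xi\to+\infty,$$ for some $A\ge0$ and $B\in\mathbb{R}$, with $B>0$ if $A=0$.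
   Context: $J\ast w(x)=\int_{\mathbb{R}}J(x-y)w(y)\,dy$; primes on $f$ denote derivatives with respect to $w$. Monostable condition on $f$: $f(\cdot;q)\in C^2([0,1])$, $f(0;q)=f(1;q)=0$, $f'(0;q)>0>f'(1;q)$, and $f(w;q)>0$ for all $w\in(0,1)$. Linear speed: with $h(\lambda)=\int_{\mathbb{R}}J(z)e^{\lambda z}\,dz-1+f'(0;q)$, $$c_0^*:=\min_{\lambda>0}\frac{h(\lambda)}{\lambda},$$ and $\lambda_0>0$ is the unique positive number with $h(\lambda_0)=c_0^*\lambda_0$. Traveling waves and minimal speed: under the monostable condition there is a number $c_{NL}^*(q)\ge c_0^*$ (the minimal traveling wave speed) such that the problem $$J\ast\mathcal{W}+c\,\mathcal{W}'+f(\mathcal{W};q)-\mathcal{W}=0\ \text{ on }\mathbb{R},\quad \mathcal{W}(-\infty)=1,\ \mathcal{W}(+\infty)=0,\quad \mathcal{W}'<0\ \text{ on }\mathbb{R}$$ has a solution $\mathcal{W}$ if and only if $c\ge c_{NL}^*(q)$, and for each such $c$ the solution is unique up to translation. The solution for $c=c_{NL}^*(q)$ is the minimal traveling wave, denoted $\mathcal{W}_q$. *)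

(* Defs.v *)
From HB Require Import structures.
From mathcomp Require Import all_boot all_order all_algebra.
From mathcomp Require Import all_classical all_reals all_analysis.

Set Implicit Arguments.
Unset Strict Implicit.
Unset Printing Implicit Defensive.

Import Order.TTheory GRing.Theory Num.Theory.
Import numFieldNormedType.Exports.

Local Open Scope classical_set_scope.
Local Open Scope ring_scope.

(* Needed by the Landau notation at +oo, which expects a canonical filter_on. *)
Canonical pinfty_filter_on (R : numFieldType) : filter_on R :=
  FilterType (pinfty_nbhs R) proper_pinfty_nbhs.

Section Defs.
Variable R : realType.

Let mu : set R -> \bar R := @lebesgue_measure R.

(* No continuity of J is assumed; integrability of J follows from ker_ge0 and
   ker_int, the integral in ker_int being extended-real valued. *)
Record dispersal_kernel (J : R -> R) : Prop := DispersalKernel {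
  ker_meas : measurable_fun [set: R] J ;
  ker_ge0 : forall z, 0 <= J z ;
  ker_supp : compact (closure [set z | J z != 0]) ;
  ker_sym : forall z, J (- z) = J z ;
  ker_int : (\int[mu]_z (J z)%:E = 1)%E }.

(* Derivatives relative to a set, one-sided at the endpoints of an interval:
   f need not be regular (or meaningful) outside A. *)
Definition diffquo_on (A : set R) (f : R -> R) (x : R) : set_system R :=
  (f y - f x) / (y - x) @[y --> within A x^'].

Definition derivable_on (A : set R) (f : R -> R) : Prop :=
  forall x, A x -> cvg (diffquo_on A f x).

Definition derive_on (A : set R) (f : R -> R) (x : R) : R :=
  lim (diffquo_on A f x).

Definition C2_on (A : set R) (f : R -> R) : Prop :=
  [/\ derivable_on A f,
      derivable_on A (derive_on A f)
    & {within A, continuous (derive_on A (derive_on A f))}].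

Definition deriv01 : (R -> R) -> R -> R := derive_on `[0, 1].

Record monostable (f : R -> R) : Prop := Monostable {
  mono_C2 : C2_on `[0, 1] f ;
  mono_f0 : f 0 = 0 ;
  mono_f1 : f 1 = 0 ;
  mono_df0 : 0 < deriv01 f 0 ;
  mono_df1 : deriv01 f 1 < 0 ;
  mono_gt0 : forall w, 0 < w < 1 -> 0 < f w }.

Definition convol (J w : R -> R) (x : R) : R :=
  \int[mu]_y (J (x - y) * w y).

Definition hfun (J f : R -> R) (lambda : R) : R :=
  \int[mu]_z (J z * expR (lambda * z)) - 1 + deriv01 f 0.

Definition is_linear_speed (J f : R -> R) (c0 : R) : Prop :=
  let S := [set hfun J f lambda / lambda | lambda in [set l | 0 < l]] in
  S c0 /\ lbound S c0.

Record traveling_wave (J f : R -> R) (c : R) (W : R -> R) : Prop :=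
  TravelingWave {
  tw_derivable : forall x, derivable W x 1 ;
  tw_eq : forall x, convol J W x + c * derive1 W x + f (W x) - W x = 0 ;
  tw_ninfty : W x @[x --> -oo] --> (1 : R) ;
  tw_pinfty : W x @[x --> +oo] --> (0 : R) ;
  tw_decr : forall x, derive1 W x < 0 }.

Definition is_minimal_speed (J f : R -> R) (cNL : R) : Prop :=
  forall c, (exists W, traveling_wave J f c W) <-> cNL <= c.

End Defs.

(* Main.v *)
(** Put [u x = expR (lambda0 x) W x], [K z = J z expR (lambda0 z)] and
    [T F = K * F - (int K) F + c F']. Minimality of [h(l)/l] at [lambda0] gives
    [c = int z K], so [T] annihilates affine functions, and the wave equation
    reads [T u = g] with [g = O(W u)]. If [U'' = u], then [v = T U] satisfies
    [v'' = g] exactly, and by Taylor's formula [v] lies between the minimum and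
    the maximum of [u] on a fixed window, times [int z^2 K / 2]. A Harnack
    inequality makes [v] and [u] comparable, so [v'' = o(v)] and [v] grows
    subexponentially; hence [g] decays exponentially and
    [v = a x + b + O(expR (- d x))], with [a >= 0], and [b > 0] if [a = 0].

    To return from [v] to [u], let [r] be [u] minus the affine function with the
    same image under the averaging. Near a maximum of the quotient of [r] by
    [expR (- e x) + eta expR (e x)], the equation [T r = g] transports closeness
    to the maximum to the right because [c > 0]; on a whole window [r] is then
    close to the barrier, which contradicts the smallness of the average of [r]
    there, unless [r = O(expR (- e x))]. *)

Require Import Defs.
From HB Require Import structures.
From mathcomp Require Import all_boot all_order all_algebra.
From mathcomp Require Import all_classical all_reals all_analysis.
From mathcomp Require Import measurable_realfun ring lra.

Import Order.TTheory GRing.Theory Num.Theory.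
Import numFieldNormedType.Exports.

Local Open Scope classical_set_scope.
Local Open Scope ring_scope.

(** * Calculus on the real line *)

Section CalculusRules.
Variable R : realType.
Implicit Types F G : R -> R.

Lemma is_derive_add F G (x a b : R) : is_derive x 1 F a ->
  is_derive x 1 G b -> is_derive x 1 (fun t => F t + G t) (a + b).
Proof. by move=> ? ?; exact: is_deriveD. Qed.

Lemma is_derive_opp F (x a : R) : is_derive x 1 F a ->
  is_derive x 1 (fun t => - F t) (- a).
Proof. by move=> ?; exact: is_deriveN. Qed.

Lemma is_derive_scale F (k x a : R) : is_derive x 1 F a ->
  is_derive x 1 (fun t => k * F t) (k * a).
Proof. by move=> ?; exact: is_deriveZ. Qed.

Lemma is_derive_mul F G (x a b : R) : is_derive x 1 F a ->
  is_derive x 1 G b -> is_derive x 1 (fun t => F t * G t) (a * G x + F x * b).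
Proof.
move=> ? ?; rewrite addrC (mulrC a).
exact: is_deriveM.
Qed.

Lemma is_derive_pow (n : nat) (x : R) :
  is_derive x 1 (fun t => t ^+ n) (n%:R * x ^+ n.-1).
Proof.
have -> : (fun t : R => t ^+ n) = id ^+ n by rewrite exprfctE.
by apply: is_derive_eq; rewrite /GRing.scale/= mulr1.
Qed.

Lemma is_derive_exp (k x : R) :
  is_derive x 1 (fun t => expR (k * t)) (k * expR (k * x)).
Proof.
have dk : is_derive x 1 (fun t : R => k * t) (k * 1).
  by apply: is_derive_scale; exact: is_derive_id.
have de := is_derive_expR (k * x).
have := @is_derive1_comp R expR (fun t => k * t) x _ _ de dk.
by rewrite /GRing.scale/= mulr1 mulrC.
Qed.

Lemma is_derive_val F (x a b : R) : is_derive x 1 F a -> a = b ->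
  is_derive x 1 F b.
Proof. by move=> ? <-. Qed.

End CalculusRules.

(* [is_derive] is a class, and instance resolution would pick derivatives in
   uncontrolled forms: hence the syntax-directed [notypeclasses] rules. *)
Ltac derive_step :=
  match goal with
  | |- is_derive _ _ (fun _ => ?k) _ => notypeclasses refine (is_derive_cst k _ _)
  | |- is_derive _ _ (fun t => t) _ => notypeclasses refine (is_derive_id _ _)
  | |- is_derive _ _ (fun t => - _) _ =>
      notypeclasses refine (is_derive_opp _ _ _ _ _)
  | |- is_derive _ _ (fun t => _ + _) _ =>
      notypeclasses refine (is_derive_add _ _ _ _ _ _ _ _)
  | |- is_derive _ _ (fun t => expR (?k * t)) _ =>
      notypeclasses refine (is_derive_exp _ k _)
  | |- is_derive _ _ (fun t => t ^+ ?n) _ =>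
      notypeclasses refine (is_derive_pow _ n _)
  | |- is_derive _ _ (fun t => ?k * _) _ =>
      notypeclasses refine (is_derive_scale _ _ k _ _ _)
  | |- is_derive _ _ (fun t => _ * _) _ =>
      notypeclasses refine (is_derive_mul _ _ _ _ _ _ _ _)
  | |- is_derive _ _ ( *%R ?k) _ =>
      notypeclasses refine (is_derive_scale _ id k _ _ (is_derive_id _ _))
  | H : _ |- is_derive _ _ _ _ =>
      first [exact H | notypeclasses refine (H _)]
  end.

Ltac derive_tac :=
  notypeclasses refine (is_derive_val _ _ _ _ _ _ _); [repeat derive_step|cbv beta].

(** * Quadratic error criterion, mean value consequences, Taylor and Gronwall bounds *)

Section Calculus.
Variable R : realType.
Implicit Types F G : R -> R.

(** A quadratic error bound is the form in which Taylor's formula survives a positive functional.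
    Derivatives pass under the functional through this criterion instead of a limit theorem for
    integrals. *)
Lemma is_derive_quad F (x d C : R) :
  (forall h, `|h| <= 1 -> `|F (x + h) - F x - h * d| <= C * h ^+ 2) ->
  is_derive x 1 F d.
Proof.
move=> FC.
have C0 : 0 <= C.
  have := FC 1; rewrite normr1 expr1n mulr1 => /(_ (lexx _)).
  exact: le_trans.
have cv : h^-1 *: (F (h *: 1 + x) - F x) @[h --> 0^'] --> d.
  apply/cvgrPdist_le => e e0; near=> h.
  have h0 : h != 0 by near: h; exact: nbhs_dnbhs_neq.
  have hn : 0 < `|h| by rewrite normr_gt0.
  have h1 : `|h| <= Num.min 1 (e / (C + 1)).
    near: h; apply: dnbhs0_le; rewrite lt_min ltr01/= divr_gt0//; lra.
  move: h1; rewrite le_min => /andP[h1 h2].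
  have := FC h h1; rewrite [X in F X]addrC.
  have -> : F (h + x) - F x - h * d =
      - h * (d - h^-1 *: (F (h *: 1 + x) - F x)).
    rewrite /GRing.scale/= mulr1; field.
    exact: h0.
  rewrite normrM normrN -(real_normK (num_real h)) => H.
  have {}H : `|d - h^-1 *: (F (h *: 1 + x) - F x)| <= C * `|h|.
    by rewrite -(ler_pM2l hn); apply: (le_trans H); rewrite expr2 mulrCA.
  apply: (le_trans H).
  apply: le_trans (ler_wpM2l C0 h2) _.
  rewrite mulrA ler_pdivrMr; last lra.
  have := ltW e0; nra.
by apply: DeriveDef; [apply/cvg_ex; exists d|exact/cvg_lim].
Unshelve. all: by end_near. Qed.

Lemma is_derive_continuous F (F1 : R -> R) :
  (forall x : R, is_derive x 1 F (F1 x)) -> continuous F.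
Proof.
by move=> dF x; apply/differentiable_continuous/derivable1_diffP/ex_derive.
Qed.

Lemma mean_value F (F1 : R -> R) (a b : R) : a <= b ->
  (forall t, a <= t <= b -> is_derive t 1 F (F1 t)) ->
  exists2 t, a <= t <= b & F b - F a = F1 t * (b - a).
Proof.
move=> ab dF; have [| |t] := @MVT_segment R F F1 a b ab.
- move=> t; rewrite in_itv/= => /andP[/ltW at_ /ltW tb].
  by apply: dF; rewrite at_ tb.
- apply: derivable_within_continuous => t; rewrite in_itv/= => tab.
  by have [] := dF t tab.
- by rewrite in_itv/= => tab Fab; exists t.
Qed.

Lemma nondecreasing_deriv F (F1 : R -> R) (a b : R) : a <= b ->
  (forall t, a <= t <= b -> is_derive t 1 F (F1 t)) ->
  (forall t, a <= t <= b -> 0 <= F1 t) -> F a <= F b.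
Proof.
move=> ab dF F10; have [t tab /eqP] := mean_value F F1 a b ab dF.
have := F10 t tab; nra.
Qed.

Lemma nonincreasing_deriv F (F1 : R -> R) (a b : R) : a <= b ->
  (forall t, a <= t <= b -> is_derive t 1 F (F1 t)) ->
  (forall t, a <= t <= b -> F1 t <= 0) -> F b <= F a.
Proof.
move=> ab dF F10; have [t tab /eqP] := mean_value F F1 a b ab dF.
have := F10 t tab; nra.
Qed.

(** Subtracting a parabola of curvature [m] leaves a derivative [D] that is nondecreasing on the
    window. Hence [D t - D x] has the sign of [t - x], and [G] is minimal at [x]. *)
Lemma taylor2_ge F (F1 F2 : R -> R) (L x m z : R) :
  (forall t : R, is_derive t 1 F (F1 t)) -> (forall t : R, is_derive t 1 F1 (F2 t)) ->
  (forall t, `|t - x| <= L -> m <= F2 t) -> `|z| <= L ->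
  m * (z ^+ 2 / 2) <= F (x - z) - F x + z * F1 x.
Proof.
move=> dF dF1 F2m zL.
pose D t := F1 t - m * t.
have dD (t : R) : is_derive t 1 D (F2 t - m * 1).
  by rewrite /D; derive_tac.
pose G t := F t - t * F1 x - m * ((t - x) ^+ 2 / 2).
have dG (t : R) : is_derive t 1 G (D t - D x).
  have -> : G = fun t => F t + ((m * x - F1 x) * t + (- (m / 2)) * t ^+ 2
      + (- (m / 2 * x ^+ 2))).
    by apply/funext => s; rewrite /G; field.
  by derive_tac; rewrite /D /= expr1; field.
suff : G x <= G (x - z) by rewrite /G; lra.
move: zL; have [z0|z0] := leP 0 z => zL.
- rewrite ger0_norm// in zL.
  apply: (nonincreasing_deriv G (fun t => D t - D x)) => //; first lra.
  move=> t tab; suff : D t <= D x by lra.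
  apply: (nondecreasing_deriv D (fun t => F2 t - m * 1)) => //; first lra.
  move=> s sab; suff : m <= F2 s by lra.
  by apply: F2m; rewrite ler_norml; lra.
- rewrite ltr0_norm// in zL.
  apply: (nondecreasing_deriv G (fun t => D t - D x)) => //; first lra.
  move=> t tab; suff : D x <= D t by lra.
  apply: (nondecreasing_deriv D (fun t => F2 t - m * 1)) => //; first lra.
  move=> s sab; suff : m <= F2 s by lra.
  by apply: F2m; rewrite ler_norml; lra.
Qed.

Lemma taylor2_le F (F1 F2 : R -> R) (L x m z : R) :
  (forall t : R, is_derive t 1 F (F1 t)) -> (forall t : R, is_derive t 1 F1 (F2 t)) ->
  (forall t, `|t - x| <= L -> F2 t <= m) -> `|z| <= L ->
  F (x - z) - F x + z * F1 x <= m * (z ^+ 2 / 2).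
Proof.
move=> dF dF1 F2m zL.
have := @taylor2_ge (fun t => - F t) (fun t => - F1 t) (fun t => - F2 t)
  L x (- m) z.
move=> /(_ _ _ _ zL) H.
have : - m * (z ^+ 2 / 2) <= - F (x - z) - - F x + z * - F1 x.
  by apply: H => t tx; rewrite lerN2; exact: F2m.
lra.
Qed.

(** With the integrating factor [expR (- p * t)], the source [q] is bounded by its weight at [a],
    the largest on the interval. This makes [G] nonincreasing. *)
Lemma gronwall F (F1 : R -> R) (a b p q : R) : a <= b -> 0 <= p -> 0 <= q ->
  (forall t, a <= t <= b -> is_derive t 1 F (F1 t)) ->
  (forall t, a <= t <= b -> F1 t <= p * F t + q) ->
  F b <= expR (p * (b - a)) * (F a + q * (b - a)).
Proof.
move=> ab p0 q0 dF Fpq.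
pose G t := expR (- p * t) * F t + (- (q * expR (- p * a))) * t.
have : G b <= G a.
  apply: (nonincreasing_deriv G (fun t => (- p * expR (- p * t)) * F t
     + expR (- p * t) * F1 t + (- (q * expR (- p * a))) * 1)) => //.
    by move=> t tab; have dFt := dF t tab; rewrite /G; derive_tac.
  move=> t tab; have e0 := expR_gt0 (- p * t).
  have ea : expR (- p * t) <= expR (- p * a) by rewrite ler_expR; nra.
  have := Fpq t tab; nra.
rewrite /G => Gab.
have e1 : expR (p * (b - a)) * expR (- p * b) = expR (- p * a).
  by rewrite -expRD; congr expR; ring.
have e2 : expR (p * b) * expR (- p * b) = 1 by rewrite -expRD mulNr subrr expR0.
have e3 : expR (p * (b - a)) = expR (p * b) * expR (- p * a).
  by rewrite -expRD; congr expR; ring.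
have : expR (- p * b) * F b <= expR (- p * a) * (F a + q * (b - a)) by lra.
rewrite -(ler_pM2l (expR_gt0 (p * b))) mulrA e2 mul1r.
by rewrite mulrA -e3.
Qed.

End Calculus.

(** * Limits at infinity with exponential rate, and primitives on the whole line *)

Section Primitives.
Variable R : realType.
Implicit Types F f : R -> R.

(** Subtracting or adding the tail [C / d * expR (- d * x)] makes [F] nondecreasing or
    nonincreasing. The limit is the number separating the two monotone families. *)
Lemma exp_decay_limit F f (X C d : R) : 0 < d -> 0 <= C ->
  (forall x, X <= x -> is_derive x 1 F (f x)) ->
  (forall x, X <= x -> `|f x| <= C * expR (- d * x)) ->
  exists l : R, forall x, X <= x -> `|F x - l| <= C / d * expR (- d * x).
Proof.
move=> d0 C0 dF fC; set D := C / d.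
have Dd : D * d = C by rewrite /D divfK// gt_eqF.
have D0 : 0 <= D by rewrite divr_ge0// ltW.
pose lo x := F x - D * expR (- d * x).
pose hi x := F x + D * expR (- d * x).
have lo_mono x y : X <= x -> x <= y -> lo x <= lo y.
  move=> Xx xy; apply: (nondecreasing_deriv _ lo
    (fun t => f t + C * expR (- d * t))) => // t /andP[xt ty].
    have dFt := dF t (le_trans Xx xt).
    by rewrite /lo; derive_tac; rewrite -Dd; ring.
  by have := fC t (le_trans Xx xt); rewrite ler_norml; lra.
have hi_mono x y : X <= x -> x <= y -> hi y <= hi x.
  move=> Xx xy; apply: (nonincreasing_deriv _ hi
    (fun t => f t - C * expR (- d * t))) => // t /andP[xt ty].
    have dFt := dF t (le_trans Xx xt).
    by rewrite /hi; derive_tac; rewrite -Dd; ring.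
  by have := fC t (le_trans Xx xt); rewrite ler_norml; lra.
have lo_hi x y : X <= x -> X <= y -> lo x <= hi y.
  move=> Xx Xy; apply: (@le_trans _ _ (lo (Num.max x y))).
    by apply: lo_mono => //; rewrite le_max lexx.
  apply: (@le_trans _ _ (hi (Num.max x y))).
    by rewrite /lo /hi; have := expR_gt0 (- d * Num.max x y); nra.
  by apply: hi_mono => //; rewrite le_max lexx orbT.
pose S := [set lo x | x in [set x | X <= x]].
have S0 : S !=set0 by exists (lo X), X => //=.
have SX : ubound S (hi X) by move=> _ [x Xx <-]; exact: lo_hi.
exists (sup S) => x Xx.
have lS : lo x <= sup S.
  by apply: ub_le_sup; [exists (hi X)|exists x].
have Sh : sup S <= hi x by apply: ge_sup => // _ [y Xy <-]; exact: lo_hi.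
by rewrite ler_norml; move: lS Sh; rewrite /lo /hi; lra.
Qed.

Lemma continuous_primitive f : continuous f ->
  exists F, forall x : R, is_derive x 1 F (f x).
Proof.
move=> cf; pose mu := @lebesgue_measure R.
pose V a x := \int[mu]_(t in [set` `[a, x]]) f t.
have dV (a x : R) : a < x -> is_derive x 1 (V a) (f x).
  move=> ax; have xx1 : x < x + 1 by rewrite ltrDl.
  have fi : mu.-integrable `[a, x + 1] (EFin \o f).
    apply: continuous_compact_integrable; first exact: segment_compact.
    exact: continuous_subspaceT.
  have [dVx <-] := @continuous_FTC1_closed R f a x _ xx1 fi ax (cf x).
  by apply: DeriveDef => //; rewrite derive1E.
have VV (a b x : R) : a <= b -> b < x -> b < 0 ->
    V a x - V a 0 = V b x - V b 0.
  move=> ab bx b0.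
  suff [c _] : exists2 c, Num.min x 0 <= c <= Num.max x 0 &
      (V a (Num.max x 0) - V b (Num.max x 0)) -
      (V a (Num.min x 0) - V b (Num.min x 0)) = 0.
    by case: (leP x 0) => _; lra.
  have [||t tx ->] := @mean_value R (fun t => V a t - V b t) (fun=> 0)
    (Num.min x 0) (Num.max x 0).
  - by rewrite ge_min le_max lexx.
  - move=> t /andP[xt _].
    have bt : b < t by apply: lt_le_trans xt; rewrite lt_min bx b0.
    have dVa := dV a t (le_lt_trans ab bt); have dVb := dV b t bt.
    by derive_tac; rewrite subrr.
  - by exists t => //; rewrite mul0r.
(* [V a] is a primitive only to the right of [a], so the base point moves with [x] and stays below
   both [x] and [0]. Subtracting the value at [0] makes the result independent of the base point, by
   [VV]; the fixed base [- (|x| + 2)] then serves for all [t] near [x]. *)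
exists (fun x => V (- (`|x| + 1)) x - V (- (`|x| + 1)) 0) => x.
have dVx : is_derive x 1 (fun t => V (- (`|x| + 2)) t - V (- (`|x| + 2)) 0) (f x).
  have dVx : is_derive x 1 (V (- (`|x| + 2))) (f x).
    by apply: dV; have := ler_norm (- x); rewrite normrN; lra.
  by derive_tac; rewrite addr0.
apply: near_eq_is_derive dVx; near=> t.
have tx : `|x - t| < 1.
  by near: t; apply: cvgr_dist_lt => //; exact: cvg_id.
have : `|t| <= `|x| + 1.
  by have := ler_distD x t 0; rewrite !subr0 distrC; lra.
move=> tx1; apply: VV; first lra.
- by have := ler_norm (- t); rewrite normrN; lra.
- by have := normr_ge0 t; lra.
Unshelve. all: by end_near. Qed.

End Primitives.

(** * Positive functionals carried by a compact interval *)

Section ContinuityRules.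
Variable R : realType.
Implicit Types f g : R -> R.

Lemma continuous_add f g : continuous f -> continuous g ->
  continuous (fun t => f t + g t).
Proof. by move=> cf cg t; apply: cvgD; [exact: cf|exact: cg]. Qed.

Lemma continuous_opp f : continuous f -> continuous (fun t => - f t).
Proof. by move=> cf t; apply: cvgN; exact: cf. Qed.

Lemma continuous_mul f g : continuous f -> continuous g ->
  continuous (fun t => f t * g t).
Proof. by move=> cf cg t; apply: cvgM; [exact: cf|exact: cg]. Qed.

Lemma continuous_cst (k : R) : continuous (fun _ : R => k).
Proof. by move=> t; exact: cvg_cst. Qed.

Lemma continuous_idfun : continuous (fun t : R => t).
Proof. by move=> t; exact: cvg_id. Qed.

Lemma continuous_pow f (n : nat) : continuous f ->
  continuous (fun t => f t ^+ n).
Proof.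
move=> cf; elim: n => [|n IH]; first exact: continuous_cst.
under eq_fun do rewrite exprS.
exact: continuous_mul.
Qed.

Lemma continuous_comp_fun f g : continuous f -> continuous g ->
  continuous (fun t => f (g t)).
Proof. by move=> cf cg t; apply: continuous_comp; [exact: cg|exact: cf]. Qed.

Lemma continuous_maxfun f g : continuous f -> continuous g ->
  continuous (fun t => Num.max (f t) (g t)).
Proof. by move=> cf cg t; apply: continuous_max; [exact: cf|exact: cg]. Qed.

End ContinuityRules.

Ltac continuity :=
  repeat match goal with
  | |- continuous (fun _ => ?k) => exact: continuous_cst
  | |- continuous (fun t => t) => exact: continuous_idfun
  | |- continuous ( *%R ?k) => apply: (continuous_mul _ (fun=> k) (fun t => t))
  | |- continuous -%R => apply: (continuous_opp _ (fun t => t))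
  | |- continuous (fun t => - _) => apply: continuous_opp
  | |- continuous (fun t => _ + _) => apply: continuous_add
  | |- continuous (fun t => _ * _) => apply: continuous_mul
  | |- continuous (fun t => _ ^+ _) => apply: continuous_pow
  | |- continuous (fun t => Num.max _ _) => apply: continuous_maxfun
  | |- continuous (fun t => expR _) =>
      apply: (continuous_comp_fun _ expR); first exact: continuous_expR
  | H : continuous ?f |- continuous (fun t => ?f _) =>
      apply: (continuous_comp_fun _ f); first exact: H
  | |- _ => by []
  end.

(** Abstracts integration against a nonnegative kernel supported in [[-L, L]]: the support enters
    only through [pf_le], which compares functions on that interval. *)
Record positive_functional (R : realType) (L : R) (K : (R -> R) -> R) : Prop :=
  PositiveFunctional {
  pf_add : forall f g : R -> R, continuous f -> continuous g ->
    K (fun z => f z + g z) = K f + K g ;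
  pf_scale : forall (k : R) (f : R -> R), continuous f -> K (fun z => k * f z) = k * K f ;
  pf_le : forall f g : R -> R, continuous f -> continuous g ->
    (forall z, `|z| <= L -> f z <= g z) -> K f <= K g }.

(* With [K f = int K(z) f(z) dz] and [F1 = F'], this is
   [K * F - (int K) F + (int z K) F'], which annihilates affine functions. *)
Definition compensated (R : realType) (K : (R -> R) -> R) (F F1 : R -> R) (x : R) :=
  K (fun z => F (x - z) - F x + z * F1 x).

Section Functional.
Variables (R : realType) (L : R) (K : (R -> R) -> R).
Hypothesis pK : positive_functional R L K.
Implicit Types f g F : R -> R.

(** Mass, first moment and half the second moment of the kernel. *)
Let M := K (fun=> 1).
Let c := K (fun z => z).
Let s := K (fun z => z ^+ 2 / 2).

Lemma pf_cst (k : R) : K (fun=> k) = k * M.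
Proof.
rewrite -(pf_scale _ _ _ pK); last by continuity.
by congr K; apply/funext => z; rewrite mulr1.
Qed.

Lemma pf_norm_le f (B : R) : continuous f ->
  (forall z, `|z| <= L -> `|f z| <= B) -> `|K f| <= B * M.
Proof.
move=> cf fB; rewrite ler_norml -mulNr -2!pf_cst; apply/andP; split.
- apply: (pf_le _ _ _ pK); [by continuity|by []|move=> z /fB].
  by rewrite ler_norml => /andP[].
- apply: (pf_le _ _ _ pK); [by []|by continuity|move=> z /fB].
  by rewrite ler_norml => /andP[].
Qed.

Lemma compensatedE F (F1 : R -> R) (x : R) : continuous F ->
  compensated R K F F1 x = K (fun z => F (x - z)) - M * F x + c * F1 x.
Proof.
move=> cF; rewrite /compensated.
rewrite (_ : (fun z => _) = fun z => F (x - z) + (- F x + F1 x * z)); last first.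
  by apply/funext => z; ring.
rewrite !(pf_add _ _ _ pK)//; [|by continuity..].
by rewrite pf_cst (pf_scale _ _ _ pK) /M /c; [ring|continuity].
Qed.

(** The Taylor bound is integrated against the kernel: the compensated operator acts as an average
    of the second derivative over the window, of total weight [s]. *)
Lemma compensated_ge F (F1 F2 : R -> R) (x m : R) :
  (forall t : R, is_derive t 1 F (F1 t)) ->
  (forall t : R, is_derive t 1 F1 (F2 t)) ->
  (forall t, `|t - x| <= L -> m <= F2 t) -> m * s <= compensated R K F F1 x.
Proof.
move=> dF dF1 F2m; have cF := is_derive_continuous _ _ _ dF.
rewrite -(pf_scale _ _ _ pK); last by continuity.
apply: (pf_le _ _ _ pK); [by continuity|by continuity|move=> z zL].
exact: (taylor2_ge _ _ _ F2 L).
Qed.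

Lemma compensated_le F (F1 F2 : R -> R) (x m : R) :
  (forall t : R, is_derive t 1 F (F1 t)) ->
  (forall t : R, is_derive t 1 F1 (F2 t)) ->
  (forall t, `|t - x| <= L -> F2 t <= m) -> compensated R K F F1 x <= m * s.
Proof.
move=> dF dF1 F2m; have cF := is_derive_continuous _ _ _ dF.
rewrite -(pf_scale _ _ _ pK); last by continuity.
apply: (pf_le _ _ _ pK); [by continuity|by continuity|move=> z zL].
exact: (taylor2_le _ _ _ F2 L).
Qed.

Lemma compensatedD F G (F1 G1 : R -> R) (a x : R) :
  continuous F -> continuous G ->
  compensated R K (fun t => F t + a * G t) (fun t => F1 t + a * G1 t) x =
  compensated R K F F1 x + a * compensated R K G G1 x.
Proof.
move=> cF cG; rewrite !compensatedE//; last by continuity.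
rewrite (pf_add _ _ _ pK) ?(pf_scale _ _ _ pK); [|by continuity..].
by ring.
Qed.

(** Inside the functional the increment has a quadratic error uniform in [z], by Taylor's formula.
    The window has radius [L + 1] because a shift [|z| <= L] is combined with an increment
    [|h| <= 1]. *)
Lemma is_derive_compensated F (F1 F2 : R -> R) (x B : R) :
  (forall t : R, is_derive t 1 F (F1 t)) ->
  (forall t : R, is_derive t 1 F1 (F2 t)) ->
  (forall t, `|t - x| <= L + 1 -> `|F2 t| <= B) ->
  is_derive x 1 (compensated R K F F1) (compensated R K F1 F2 x).
Proof.
move=> dF dF1 F2B.
have cF := is_derive_continuous _ _ _ dF.
have cF1 := is_derive_continuous _ _ _ dF1.
have -> : compensated R K F F1 =
    fun x => K (fun z => F (x - z)) - M * F x + c * F1 x.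
  by apply/funext => y; exact: compensatedE.
rewrite compensatedE//.
suff dK : is_derive x 1 (fun x => K (fun z => F (x - z)))
    (K (fun z => F1 (x - z))) by derive_tac.
apply: (is_derive_quad _ _ _ _ (B / 2 * M)) => h h1.
rewrite mulrAC.
rewrite (_ : _ - _ - _ =
  K (fun z => F (x + h - z) + (-1) * F (x - z) + (- h) * F1 (x - z))); last first.
  by rewrite !(pf_add _ _ _ pK) ?(pf_scale _ _ _ pK); [ring|continuity..].
apply: pf_norm_le; first by continuity.
move=> z zL; rewrite (_ : F _ + _ + _ =
  F (x - z - - h) - F (x - z) + - h * F1 (x - z)); last first.
  by rewrite (_ : x - z - - h = x + h - z); ring.
have FB t : `|t - (x - z)| <= 1 -> - B <= F2 t <= B.
  move=> tx; rewrite -ler_norml; apply: F2B.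
  apply: (le_trans (ler_distD (x - z) t x)).
  rewrite addrC lerD// (_ : x - z - x = - z) ?normrN//.
  by ring.
have hN : `|- h| <= 1 by rewrite normrN.
rewrite ler_norml; apply/andP; split.
- have := @taylor2_ge R F F1 F2 1 (x - z) (- B) (- h) dF dF1 _ hN.
  rewrite sqrrN mulNr (mulrC (h ^+ 2)) mulrA => -> // t /FB/andP[]//.
- have := @taylor2_le R F F1 F2 1 (x - z) B (- h) dF dF1 _ hN.
  rewrite sqrrN (mulrC (h ^+ 2)) mulrA => -> // t /FB/andP[]//.
Qed.

End Functional.

(** * Deconvolution by a maximum principle *)

Section Barrier.
Variables (R : realType) (L : R) (K : (R -> R) -> R).
Hypothesis pK : positive_functional R L K.

Let M := K (fun=> 1).
Let c := K (fun z => z).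
Let s := K (fun z => z ^+ 2 / 2).
Hypotheses (L0 : 0 < L) (c0 : 0 < c) (s0 : 0 < s).

Lemma pf_one_ge0 : 0 <= M.
Proof.
have -> : 0 = K (fun=> 0) by rewrite (pf_cst _ _ _ pK) mul0r.
by apply: (pf_le _ _ _ pK); [continuity|continuity|].
Qed.

(** [E] bounds the variation of the barrier over a distance [L], [G] is the Gronwall factor over a
    window of length [2 * L], and [a1], [a2] weigh [e ^+ 2 * m] and [g] in the deficit estimate
    [sig_window]. *)
Let E := expR 1 : R.
Let G := expR (M / c * (2 * L)).
Let a1 := G * (1 + 2 * L * s * E ^+ 3 / c).
Let a2 := G * (2 * L * E ^+ 2 / c).

Variables (r r1 R1 R2 : R -> R) (X d g : R).
Hypotheses (X0 : 0 <= X) (d0 : 0 < d) (g0 : 0 <= g).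
Hypotheses (dr : forall x : R, is_derive x 1 r (r1 x))
  (dR1 : forall x : R, is_derive x 1 R1 (r x))
  (dR2 : forall x : R, is_derive x 1 R2 (R1 x)).
Hypothesis r_op : forall x, X <= x ->
  - (g * expR (- d * x)) <= compensated R K r r1 x.
Hypothesis R2_op : forall x, X <= x ->
  compensated R K R2 R1 x <= g * expR (- d * x).

Section Step.
Variables (e eta m xh : R).
Hypotheses (e0 : 0 < e) (ed : e <= d) (eL : e * L <= 1) (eta0 : 0 < eta).
Hypothesis a1e : a1 * e ^+ 2 <= (E ^+ 2)^-1 / 2.
Hypotheses (m0 : 0 < m) (Xxh : X + L <= xh).
(** The term in [eta] dominates subexponential growth, so that [r / phi] is bounded, and both
    exponentials satisfy [phi'' = e ^+ 2 * phi]. Here [m] bounds [r / phi], and [xh] nearly attains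
    it. *)
Let phi t := expR (- e * t) + eta * expR (e * t).
Hypothesis r_phi : forall x, X <= x -> r x <= m * phi x.
Hypothesis r_xh : (m - e ^+ 2 * m) * phi xh <= r xh.

Let phi1 t := - e * expR (- e * t) + eta * (e * expR (e * t)).

Let phi_gt0 t : 0 < phi t.
Proof. by rewrite addr_gt0 ?mulr_gt0 ?expR_gt0. Qed.

Let dphi (t : R) : is_derive t 1 phi (phi1 t).
Proof. by rewrite /phi; derive_tac. Qed.

Let dphi1 (t : R) : is_derive t 1 phi1 (e ^+ 2 * phi t).
Proof. by rewrite /phi1; derive_tac; rewrite /phi; ring. Qed.

Let phi_shift t h : `|h| <= L -> phi (t + h) <= E * phi t.
Proof.
move=> hL; rewrite /phi (mulrDr E) (mulrCA E).
have e1 k : `|k| <= e -> expR (k * (t + h)) <= E * expR (k * t).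
  move=> ke; rewrite /E -expRD ler_expR mulrDr addrC lerD2r.
  apply: le_trans eL; apply: le_trans (ler_norm _) _.
  by rewrite normrM ler_pM.
apply: lerD; first by apply: e1; rewrite normrN gtr0_norm.
by rewrite ler_pM2l//; apply: e1; rewrite gtr0_norm.
Qed.

Let E1 : 1 <= E.
Proof. by rewrite /E; have := @expR_ge1Dx R 1; lra. Qed.

(** A displacement of up to [2 * L] is split into two equal shifts, each costing a factor [E]. *)
Let phi_window t : xh <= t <= xh + 2 * L ->
  phi xh <= E ^+ 2 * phi t /\ phi t <= E ^+ 2 * phi xh.
Proof.
move=> tx; have hL : `|(t - xh) / 2| <= L by rewrite ler_norml; lra.
have hL' : `|- ((t - xh) / 2)| <= L by rewrite normrN.
have E0 : 0 < E by exact: expR_gt0.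
have A := phi_shift xh _ hL; have B := phi_shift (xh + (t - xh) / 2) _ hL.
have C := phi_shift t _ hL'; have D := phi_shift (t - (t - xh) / 2) _ hL'.
rewrite (_ : xh + (t - xh) / 2 + (t - xh) / 2 = t) in B; last by field.
rewrite (_ : t - (t - xh) / 2 - (t - xh) / 2 = xh) in D; last by field.
split.
- by apply: (le_trans D); rewrite expr2 -mulrA ler_pM2l.
- by apply: (le_trans B); rewrite expr2 -mulrA ler_pM2l.
Qed.

(** The gap to the barrier: nonpositive beyond [X] and almost zero at [xh]. *)
Let sig t := r t + (- m) * phi t.
Let sig1 t := r1 t + (- m) * phi1 t.

Let dsig (t : R) : is_derive t 1 sig (sig1 t).
Proof. by rewrite /sig; derive_tac. Qed.

Let Gam := (m * e ^+ 2 * s * E ^+ 3 + g * E ^+ 2) * phi xh.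

Let exp_phi t : 0 <= t -> expR (- d * t) <= phi t.
Proof.
move=> t0; apply: (@le_trans _ _ (expR (- e * t))).
  by rewrite ler_expR !mulNr lerN2 ler_wpM2r.
by rewrite lerDl mulr_ge0// ?expR_ge0// ltW.
Qed.

Let sig_op t : xh <= t <= xh + 2 * L -> - Gam <= compensated R K sig sig1 t.
Proof.
move=> tx; have [_ tE] := phi_window t tx.
rewrite (compensatedD _ _ _ pK); last 2 first.
- exact: is_derive_continuous dr.
- exact: is_derive_continuous dphi.
have xhX := Xxh; have Lp := L0; have Xp := X0.
have Xt : X <= t by lra.
have A := r_op t Xt.
have A1 : g * expR (- d * t) <= g * phi t.
  by apply: ler_wpM2l => //; apply: exp_phi; lra.
have B : compensated R K phi phi1 t <= e ^+ 2 * (E * phi t) * s.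
  apply: (compensated_le _ _ _ pK _ _ _ _ _ dphi dphi1) => y yt.
  apply: ler_wpM2l; first exact: sqr_ge0.
  by rewrite (_ : y = t + (y - t)); [exact: phi_shift|ring].
have B1 : m * compensated R K phi phi1 t <= m * (e ^+ 2 * (E * phi t) * s).
  by rewrite ler_pM2l.
rewrite mulNr /Gam.
have C1 : m * (e ^+ 2 * (E * phi t) * s) <= m * e ^+ 2 * s * E ^+ 3 * phi xh.
  rewrite (_ : m * (e ^+ 2 * (E * phi t) * s) = m * e ^+ 2 * s * E * phi t).
    rewrite (_ : m * e ^+ 2 * s * E ^+ 3 * phi xh =
      m * e ^+ 2 * s * E * (E ^+ 2 * phi xh)); last by ring.
    apply: ler_wpM2l => //.
    by rewrite !mulr_ge0// ?ltW// ?sqr_ge0// expR_gt0.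
  by ring.
have C2 : g * phi t <= g * E ^+ 2 * phi xh.
  by rewrite -mulrA; exact: ler_wpM2l.
lra.
Qed.

Let sig_le0 t : X <= t -> sig t <= 0.
Proof. by move=> /r_phi; rewrite /sig; lra. Qed.

Let Gam0 : 0 <= Gam.
Proof.
rewrite /Gam mulr_ge0//; last exact: ltW.
by rewrite addr_ge0// !mulr_ge0// ?sqr_ge0// ?exprn_ge0 ?expR_ge0// ltW.
Qed.

(** The nonlocal term of [sig] is nonpositive, since [X + L <= xh] keeps its arguments beyond [X].
    What remains of [sig_op] is a differential inequality for [- sig], solved to the right by
    Gronwall because [c > 0]. *)
Let sig_window t : xh <= t <= xh + 2 * L ->
  - sig t <= (a1 * e ^+ 2 * m + a2 * g) * phi xh.
Proof.
move=> /andP[xt tx]; have M0 := pf_one_ge0.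
have xhX := Xxh; have Lp := L0; have Xp := X0; have rx := r_xh.
have p0 : 0 <= M / c by rewrite divr_ge0// ltW.
have q0 : 0 <= Gam / c by rewrite divr_ge0// ltW.
have := @gronwall R (fun t => - sig t) (fun t => - sig1 t) xh t (M / c)
  (Gam / c) xt p0 q0.
move=> /(_ _ _)/le_trans; apply.
- by move=> y _; derive_tac.
- move=> y /andP[xy yt]; have yx : xh <= y <= xh + 2 * L by lra.
  have := sig_op y yx; rewrite (compensatedE _ _ _ pK); last first.
    exact: is_derive_continuous dsig.
  have Ks : K (fun z => sig (y - z)) <= 0.
    have -> : 0 = K (fun=> 0) by rewrite (pf_cst _ _ _ pK) mul0r.
    have cs := is_derive_continuous _ _ _ dsig.
    apply: (pf_le _ _ _ pK); [by continuity|by continuity|move=> z].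
    by rewrite ler_norml => zL; apply: sig_le0; lra.
  move=> H.
  have : - Gam <= c * sig1 y - M * sig y by rewrite /c /M; lra.
  move=> {}H; rewrite -(ler_pM2l c0).
  rewrite (_ : c * (M / c * - sig y + Gam / c) = - (M * sig y) + Gam); first lra.
  by field; rewrite gt_eqF.
have sx : - sig xh <= e ^+ 2 * m * phi xh by rewrite /sig; lra.
have sx0 : 0 <= - sig xh by rewrite oppr_ge0; apply: sig_le0; lra.
apply: (@le_trans _ _ (G * (e ^+ 2 * m * phi xh + Gam / c * (2 * L)))).
  apply: ler_pM.
  - exact: expR_ge0.
  - by rewrite addr_ge0// mulr_ge0//; lra.
  - by rewrite ler_expR; apply: ler_wpM2l => //; lra.
  - by apply: lerD => //; apply: ler_wpM2l => //; lra.
rewrite le_eqVlt; apply/orP; left; apply/eqP.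
rewrite /a1 /a2 /Gam; field.
by rewrite gt_eqF.
Qed.

(** On the window centred at [xh + L], [r] is at least [m * phi] minus the deficit, so its average
    [compensated R K R2 R1] is large there, while [R2_op] makes it small. Half of [m / E ^+ 2]
    absorbs the [a1] term, and the bound on [m] is free of [eta]. *)
Lemma barrier_step : m <= 2 * E ^+ 2 * (a2 + s^-1) * g.
Proof.
have E0 : 0 < E ^+ 2 by rewrite exprn_gt0 ?expR_gt0.
have px := phi_gt0 xh.
have xhX := Xxh; have Lp := L0; have Xp := X0; have ep := e0; have de := ed.
pose l := (m / E ^+ 2 - (a1 * e ^+ 2 * m + a2 * g)) * phi xh.
have A : l * s <= compensated R K R2 R1 (xh + L).
  apply: (compensated_ge _ _ _ pK _ _ r) => // t.
  rewrite ler_norml => tx.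
  have tx' : xh <= t <= xh + 2 * L by lra.
  have := sig_window t tx'; have [+ _] := phi_window t tx'.
  rewrite /sig /l => B C.
  have : m / E ^+ 2 * phi xh <= m * phi t.
    by rewrite -mulrA ler_pM2l// mulrC ler_pdivrMr// mulrC.
  lra.
have B := le_trans A (R2_op (xh + L) _).
have {}B : l * s <= g * phi xh.
  apply: (le_trans (B _)); first lra.
  apply: ler_wpM2l => //; apply: le_trans (exp_phi xh _); last lra.
  by rewrite ler_expR; nra.
have {}B : (m / E ^+ 2 - (a1 * e ^+ 2 * m + a2 * g)) <= s^-1 * g.
  rewrite -(ler_pM2r px) -(ler_pM2r s0) -/l (le_trans B)//.
  by rewrite (_ : s^-1 * g * phi xh * s = g * phi xh)//; field; rewrite gt_eqF.
have C : a1 * e ^+ 2 * m <= (E ^+ 2)^-1 / 2 * m by rewrite ler_pM2r.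
have D : m / E ^+ 2 / 2 <= (a2 + s^-1) * g by lra.
rewrite (_ : m = m / E ^+ 2 / 2 * (2 * E ^+ 2)); last first.
  by field; rewrite gt_eqF ?expR_gt0.
rewrite (_ : 2 * E ^+ 2 * (a2 + s^-1) * g = (a2 + s^-1) * g * (2 * E ^+ 2)).
  by rewrite ler_pM2r// mulr_gt0.
by ring.
Qed.

End Step.

(** Let [m] be the supremum of [r / phi]. Either [m] is controlled by [r] on [[X, X + L]], or it is
    nearly attained beyond [X + L] and [barrier_step] applies. Both bounds are independent of [eta],
    which then tends to zero at a fixed point. *)
Lemma barrier :
  (forall e, 0 < e -> exists C, forall x, X <= x -> r x <= C * expR (e * x)) ->
  exists e C, [/\ 0 < e, 0 <= C & forall x, X <= x -> r x <= C * expR (- e * x)].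
Proof.
move=> rexp.
have M0 := pf_one_ge0.
have E0 : 0 < E ^+ 2 by rewrite exprn_gt0 ?expR_gt0.
have a10 : 0 < a1.
  rewrite mulr_gt0 ?expR_gt0// ltr_pwDl// divr_ge0 ?(ltW c0)//.
  by rewrite !mulr_ge0// ?exprn_ge0 ?expR_ge0// ltW.
have a20 : 0 <= a2.
  rewrite mulr_ge0 ?expR_ge0// divr_ge0 ?(ltW c0)//.
  by rewrite !mulr_ge0 ?(ltW L0) ?expR_ge0.
(* The bound by [1] gives [e ^+ 2 <= e], so that the last bound yields [a1e]; the other two give
   [ed] and [eL]. *)
pose e := Num.min (Num.min d L^-1) (Num.min 1 ((E ^+ 2)^-1 / 2 / a1)).
have e0 : 0 < e.
  by rewrite /e !lt_min d0 invr_gt0 L0 ltr01/= !divr_gt0// invr_gt0.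
have [ed eL e1 ea] : [/\ e <= d, e <= L^-1, e <= 1 & e <= (E ^+ 2)^-1 / 2 / a1].
  by rewrite /e; split; rewrite !ge_min lexx ?orbT.
have eL1 : e * L <= 1 by rewrite -ler_pdivlMr// div1r.
have a1e : a1 * e ^+ 2 <= (E ^+ 2)^-1 / 2.
  move: ea; rewrite ler_pdivlMr// => ea; apply: le_trans ea.
  rewrite mulrC ler_pM2r// expr2; nra.
have [C1 rC1] := rexp 1 ltr01.
pose Kr := `|C1| * expR (X + L).
have rKr x : X <= x <= X + L -> r x <= Kr.
  move=> /andP[Xx xL]; apply: (le_trans (rC1 x Xx)); rewrite mul1r.
  apply: (@le_trans _ _ (`|C1| * expR x)).
    by rewrite ler_wpM2r ?expR_ge0// ler_norm.
  by rewrite ler_wpM2l// ler_expR.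
have Kr0 : 0 <= Kr by rewrite mulr_ge0 ?expR_ge0.
(* [K0 * expR (- e * x)] dominates [r] on [[X, X + L]], and [K1] is the bound of [barrier_step]. *)
pose K0 := Kr * expR (e * (X + L)).
pose K1 := 2 * E ^+ 2 * (a2 + s^-1) * g.
have K00 : 0 <= K0 by rewrite mulr_ge0 ?expR_ge0.
pose KK := Num.max K0 K1.
have KK0 : 0 <= KK by rewrite le_max K00.
exists e, KK; split => // x0 Xx0.
suff H eta : 0 < eta -> r x0 <= KK * (expR (- e * x0) + eta * expR (e * x0)).
  apply/ler_addgt0Pr => eps eps0.
  have k0 : 0 < KK * expR (e * x0) + 1.
    by rewrite ltr_wpDl// mulr_ge0 ?expR_ge0.
  have := H (eps / (KK * expR (e * x0) + 1)); rewrite divr_gt0// => /(_ isT).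
  move=> /le_trans; apply; rewrite mulrDr lerD2l mulrCA.
  by rewrite mulrAC ler_pdivrMr// ler_pM2l// lerDl.
move=> eta0; pose phi t := expR (- e * t) + eta * expR (e * t).
have phi0 t : 0 < phi t by rewrite addr_gt0 ?mulr_gt0 ?expR_gt0.
pose S := [set r x / phi x | x in [set x | X <= x]].
have S0 : S !=set0 by exists (r X / phi X), X => //=.
have Sub : has_ubound S.
  have [C rC] := rexp e e0; exists (`|C| / eta) => _ [x Xx <-].
  rewrite ler_pdivrMr//; apply: (le_trans (rC x Xx)).
  apply: (@le_trans _ _ (`|C| * expR (e * x))).
    by rewrite ler_wpM2r ?expR_ge0// ler_norm.
  rewrite /phi mulrDr [X in _ <= _ + X]mulrA divfK ?gt_eqF//.
  by rewrite lerDr mulr_ge0 ?expR_ge0// divr_ge0// ltW.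
set m := sup S.
have r_phi x : X <= x -> r x <= m * phi x.
  by move=> Xx; rewrite -ler_pdivrMr//; apply: ub_le_sup => //; exists x.
suff mK : m <= KK by rewrite (le_trans (r_phi x0 Xx0))// ler_pM2r.
rewrite leNgt; apply/negP; rewrite gt_max => /andP[K0m K1m].
have m0 : 0 < m by exact: le_lt_trans K0m.
(* The first tolerance is the one required by [barrier_step]; the second forces the near-maximum
   point out of [[X, X + L]]. *)
pose tau := Num.min (e ^+ 2 * m) (m - K0).
have tau0 : 0 < tau by rewrite lt_min subr_gt0 K0m mulr_gt0// exprn_gt0.
have [t1 t2] : tau <= e ^+ 2 * m /\ tau <= m - K0.
  by rewrite /tau; split; rewrite ge_min lexx ?orbT.
have [_ [xh Xxh <-]] := @sup_adherent _ _ _ tau0 (conj S0 Sub).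
rewrite -/m ltr_pdivlMr// => mr.
have xhL : X + L <= xh.
  rewrite leNgt; apply/negP => xhL.
  have := rKr xh; rewrite Xxh (ltW xhL) => /(_ isT) rK.
  have : Kr <= K0 * phi xh.
    apply: (@le_trans _ _ (K0 * expR (- e * xh))).
      rewrite /K0 -mulrA -expRD mulNr -mulrBr ler_peMr// -[leLHS]expR0 ler_expR.
      by rewrite mulr_ge0 ?(ltW e0)// subr_ge0 ltW.
    by rewrite ler_wpM2l// lerDl mulr_ge0 ?expR_ge0// ltW.
  have := phi0 xh; nra.
suff mK1 : m <= K1 by move: K1m; rewrite ltNge mK1.
apply: (barrier_step e eta m xh) => //.
apply: le_trans (ltW mr); rewrite ler_pM2r; last exact: phi0.
by rewrite lerD2l lerN2.
Qed.

End Barrier.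

(** * Positive solutions of [v'' = o(v)] *)

Section PositiveSolutions.
Variable R : realType.
Implicit Types F f v : R -> R.

Lemma continuous_locally_bounded f (x D : R) : continuous f -> 0 <= D ->
  exists B : R, forall t, `|t - x| <= D -> `|f t| <= B.
Proof.
move=> cf D0; have xD : x - D <= x + D by lra.
have [|t _ tmax] := @EVT_max R (fun t => `|f t|) _ _ xD.
  apply: continuous_subspaceT => y.
  exact: (continuous_comp (cf y) (@norm_continuous _ _ _)).
exists `|f t| => y yx; apply: tmax.
by move: yx; rewrite in_itv/= ler_norml; lra.
Qed.

Lemma exp_le_eventually (k d e : R) : 0 < d -> 0 < e ->
  exists2 X, 0 <= X & forall x, X <= x -> k * expR (- d * x) <= e.
Proof.
move=> d0 e0; exists (`|k| / (d * e)).
  by rewrite divr_ge0 ?mulr_ge0// ltW.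
move=> x Xx; have k0 := ler_norm k; have kn := normr_ge0 k.
have x0 : 0 <= x by apply: le_trans Xx; rewrite divr_ge0 ?mulr_ge0// ltW.
rewrite mulNr expRN ler_pdivrMr ?expR_gt0//.
move: Xx; rewrite ler_pdivrMr ?mulr_gt0// => Xx.
have := expR_ge1Dx (d * x); nra.
Qed.

(** The bound with [C'] only serves to identify the limit of [F] as zero; the constant then improves
    to [C / d], whatever [C'] was. *)
Lemma exp_decay_bound F f (X C C' d : R) : 0 < d -> 0 <= C ->
  (forall x, X <= x -> is_derive x 1 F (f x)) ->
  (forall x, X <= x -> `|f x| <= C * expR (- d * x)) ->
  (forall x, X <= x -> `|F x| <= C' * expR (- d * x)) ->
  forall x, X <= x -> `|F x| <= C / d * expR (- d * x).
Proof.
move=> d0 C0 dF fC FC x Xx.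
have [l Fl] := exp_decay_limit R F f X C d d0 C0 dF fC.
suff l0 : `|l| <= 0.
  move: l0; rewrite normr_le0 => /eqP l0; have := Fl x Xx.
  by rewrite l0 subr0.
apply/ler_addgt0Pr => e e0; rewrite add0r.
have [Y _ Ye] := exp_le_eventually (C' + C / d) d e d0 e0.
have XY : X <= Num.max X Y by rewrite le_max lexx.
have YY : Y <= Num.max X Y by rewrite le_max lexx orbT.
have := Fl _ XY; have := FC _ XY; have := Ye _ YY.
have := ler_distD (F (Num.max X Y)) l 0; rewrite !subr0 (distrC l).
lra.
Qed.

Section SecondOrder.
Variables (v v1 v2 : R -> R).
Hypotheses (dv : forall x : R, is_derive x 1 v (v1 x))
  (dv1 : forall x : R, is_derive x 1 v1 (v2 x)).
Hypothesis v_gt0 : forall x, 0 < v x.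

(** Factor [v'' - eta ^+ 2 * v] as first-order operators: [expR (- eta * x) * (v' + eta * v)] is
    nonincreasing. Positivity of [v] then bounds [v'] by a multiple of [expR (eta * x)], which is
    integrated. *)
Lemma subexponential_growth (X eta : R) : 0 <= X -> 0 < eta ->
  (forall x, X <= x -> v2 x <= eta ^+ 2 * v x) ->
  exists2 C, 0 <= C & forall x, X <= x -> v x <= C * expR (eta * x).
Proof.
move=> X0 eta0 v2v.
pose E x := expR (- eta * x) * (v1 x + eta * v x).
have E_mono x : X <= x -> E x <= E X.
  move=> Xx; apply: (nonincreasing_deriv _ E
    (fun t => expR (- eta * t) * (v2 t - eta ^+ 2 * v t))) => //.
    by move=> t _; rewrite /E; derive_tac; ring.
  move=> t /andP[Xt _]; have := v2v t Xt; have := expR_gt0 (- eta * t).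
  rewrite pmulr_rle0 ?expR_gt0//; lra.
pose C := `|E X|.
have v1C x : X <= x -> v1 x <= C * expR (eta * x).
  move=> Xx; have EC : E x <= C by apply: le_trans (E_mono x Xx) (ler_norm _).
  have := v_gt0 x; move: EC.
  rewrite /E mulNr expRN mulrC ler_pdivrMr ?expR_gt0//.
  have := eta0; nra.
have D_mono x : X <= x ->
    v x - C / eta * expR (eta * x) <= v X - C / eta * expR (eta * X).
  move=> Xx; apply: (nonincreasing_deriv _
    (fun x => v x - C / eta * expR (eta * x))
    (fun t => v1 t - C * expR (eta * t))) => //.
    by move=> t _; derive_tac; field; rewrite gt_eqF.
  by move=> t /andP[Xt _]; have := v1C t Xt; lra.
have Ce : 0 <= C / eta by rewrite divr_ge0 ?normr_ge0 ?(ltW eta0).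
exists (C / eta + v X); first by rewrite addr_ge0// ltW.
move=> x Xx; have := D_mono x Xx; have := expR_gt0 (eta * X).
have e1 : 1 <= expR (eta * x).
  by rewrite -[leLHS]expR0 ler_expR mulr_ge0 ?(ltW eta0)// (le_trans X0).
have := v_gt0 X; nra.
Qed.

Lemma linear_asymptotics (X C d : R) : 0 < d -> 0 <= C ->
  (forall x, X <= x -> `|v2 x| <= C * expR (- d * x)) ->
  exists a b : R, forall x, X <= x ->
    `|v1 x - a| <= C / d * expR (- d * x) /\
    `|v x - a * x - b| <= C / d / d * expR (- d * x).
Proof.
move=> d0 C0 v2C.
have [a v1a] := exp_decay_limit R v1 v2 X C d d0 C0 (fun x _ => dv1 x) v2C.
have Cd0 : 0 <= C / d by rewrite divr_ge0// ltW.
have [|b vb] := exp_decay_limit R (fun x => v x - a * x) (fun x => v1 x - a)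
  X (C / d) d d0 Cd0 _ v1a.
  by move=> x _; derive_tac; rewrite mulr1.
by exists a, b => x Xx; split; [exact: v1a|exact: vb].
Qed.

(* If both coefficients vanished, [v] would be [O(expR (- d x))], and the second
   bound on [v2] would improve any such estimate by a factor 2. *)
Lemma positive_asymptotics (X C d a b : R) : 0 <= X -> 0 < d -> 0 <= C ->
  (forall x, X <= x -> `|v2 x| <= C * expR (- d * x) * v x) ->
  (forall x, X <= x -> `|v1 x - a| <= C * expR (- d * x)) ->
  (forall x, X <= x -> `|v x - a * x - b| <= C * expR (- d * x)) ->
  0 <= a /\ (a = 0 -> 0 < b).
Proof.
move=> X0 d0 C0 v2C v1C vC.
have ex1 x : X <= x -> expR (- d * x) <= 1.
  move=> Xx; rewrite -[leRHS]expR0 ler_expR mulNr oppr_le0.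
  by rewrite mulr_ge0 ?(ltW d0)// (le_trans X0).
split.
  rewrite leNgt; apply/negP => a0.
  (* At this point [a * x + b + C <= a * X <= 0], which contradicts [0 < v x]. *)
  pose x := X + (`|b| + C) / (- a).
  have Xx : X <= x by rewrite lerDl divr_ge0 ?addr_ge0// oppr_ge0 ltW.
  have := vC x Xx; have := v_gt0 x; have := ex1 x Xx; have := ler_norm b.
  have ax : a * x = a * X - (`|b| + C).
    by rewrite /x; field; rewrite lt_eqF.
  rewrite ler_norml ax; have := expR_gt0 (- d * x); nra.
move=> a0; rewrite ltNge; apply/negP => b0.
have vC' x : X <= x -> v x <= C * expR (- d * x).
  by move=> Xx; have := vC x Xx; rewrite a0 ler_norml; lra.
have vC'' x : X <= x -> `|v x| <= C * expR (- d * x).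
  by move=> Xx; rewrite gtr0_norm//; exact: vC'.
have {}v1C x : X <= x -> `|v1 x| <= C * expR (- d * x).
  by move=> Xx; have := v1C x Xx; rewrite a0 subr0.
have d2 : 0 < d ^+ 2 / 2 by rewrite divr_gt0// exprn_gt0.
(* Beyond [Y] the coefficient of [v] in the bound on [v2] is at most [d ^+ 2 / 2]; two integrations
   divide by [d ^+ 2], leaving the factor [1 / 2]. *)
have [Y Y0 Yd] := exp_le_eventually C d (d ^+ 2 / 2) d0 d2.
pose Z := Num.max X Y.
have XZ x : Z <= x -> X <= x by rewrite ge_max => /andP[].
have YZ x : Z <= x -> Y <= x by rewrite ge_max => /andP[].
pose S := [set v x * expR (d * x) | x in [set x | Z <= x]].
have S0 : S !=set0 by exists (v Z * expR (d * Z)), Z => //=.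
have SC : ubound S C.
  move=> _ [x Zx <-]; rewrite -ler_pdivlMr ?expR_gt0// -expRN -mulNr.
  exact/vC'/XZ.
have vS x : Z <= x -> v x <= sup S * expR (- d * x).
  move=> Zx; rewrite mulNr expRN ler_pdivlMr ?expR_gt0//.
  by apply: ub_le_sup; [exists C|exists x].
have m0 : 0 < sup S.
  apply: (@lt_le_trans _ _ (v Z * expR (d * Z))).
    by rewrite mulr_gt0 ?expR_gt0.
  by apply: ub_le_sup; [exists C|exists Z => //=].
set m := sup S in m0 vS.
have q0 : 0 <= d ^+ 2 / 2 * m by rewrite mulr_ge0 ?ltW.
have v2m x : Z <= x -> `|v2 x| <= d ^+ 2 / 2 * m * expR (- d * x).
  move=> Zx; apply: (le_trans (v2C x (XZ _ Zx))); rewrite -[leRHS]mulrA.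
  apply: ler_pM; [|exact: (ltW (v_gt0 _))|exact/Yd/YZ|exact: vS].
  by rewrite mulr_ge0 ?expR_ge0.
have v1m := exp_decay_bound v1 v2 Z _ C d d0 q0 (fun x _ => dv1 x) v2m
  (fun x Zx => v1C x (XZ _ Zx)).
have q1 : 0 <= d ^+ 2 / 2 * m / d by rewrite divr_ge0 ?(ltW d0).
have vm := exp_decay_bound v v1 Z _ C d d0 q1 (fun x _ => dv x) v1m
  (fun x Zx => vC'' x (XZ _ Zx)).
have : m <= m / 2.
  apply: ge_sup => // _ [x Zx <-].
  have := vm x Zx; rewrite gtr0_norm//.
  rewrite -ler_pdivlMr ?expR_gt0// -expRN -mulNr.
  rewrite (_ : d ^+ 2 / 2 * m / d / d = m / 2)//.
  by field; rewrite gt_eqF.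
lra.
Qed.

End SecondOrder.

End PositiveSolutions.

(** * Asymptotics at a double characteristic root *)

Section DoubleRoot.
Variables (R : realType) (L : R) (K : (R -> R) -> R).
Hypothesis pK : positive_functional R L K.

Let c := K (fun z => z).
Let s := K (fun z => z ^+ 2 / 2).
Hypotheses (L0 : 0 < L) (c0 : 0 < c) (s0 : 0 < s).

Lemma compensatedN (F F1 : R -> R) (x : R) : continuous F ->
  compensated R K (fun t => - F t) (fun t => - F1 t) x = - compensated R K F F1 x.
Proof.
move=> cF; rewrite /compensated -[RHS]mulN1r -(pf_scale _ _ _ pK); last by continuity.
by congr K; apply/funext => z; ring.
Qed.

(** Second primitives of affine functions are combinations of [t ^+ 3 / 6] and [t ^+ 2 / 2], so this
    lemma and the next compute the averages of affine functions. The third moment shifts the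
    constant term. *)
Lemma compensated_cube (x : R) :
  compensated R K (fun t => t ^+ 3 / 6) (fun t => t ^+ 2 / 2) x =
  s * x - K (fun z => z ^+ 3 / 6).
Proof.
rewrite /compensated (_ : (fun z => _) =
    fun z => x * (z ^+ 2 / 2) + (-1) * (z ^+ 3 / 6)); last first.
  by apply/funext => z; field.
rewrite (pf_add _ _ _ pK) ?(pf_scale _ _ _ pK); [|by continuity..].
by rewrite mulN1r (mulrC x).
Qed.

Lemma compensated_sqr (x : R) :
  compensated R K (fun t => t ^+ 2 / 2) (fun t => t) x = s.
Proof. by congr K; apply/funext => z; field. Qed.

Lemma compensated_affine (a b x : R) :
  compensated R K (fun t => a * t + b) (fun=> a) x = 0.
Proof.
rewrite /compensated (_ : (fun z => _) = fun=> 0); last first.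
  by apply/funext => z; ring.
by rewrite (pf_cst _ _ _ pK) mul0r.
Qed.

(** [A] and [B] are chosen so that the average of [A * x + B] is exactly [a * x + b]. The difference
    [r] then has exponentially small image and average, and the barrier applies to both [r] and
    [- r]. *)
Lemma deconvolution (u u1 U1 U2 : R -> R) (X d g a b P Q : R) :
  0 <= X -> 0 < d -> 0 <= g -> 0 <= P -> 0 <= Q ->
  (forall x : R, is_derive x 1 u (u1 x)) ->
  (forall x : R, is_derive x 1 U1 (u x)) ->
  (forall x : R, is_derive x 1 U2 (U1 x)) ->
  (forall x, X <= x -> `|compensated R K u u1 x| <= g * expR (- d * x)) ->
  (forall x, X <= x ->
    `|compensated R K U2 U1 x - a * x - b| <= g * expR (- d * x)) ->
  (forall x, X <= x -> `|u x| <= P * x + Q) ->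
  let A := a / s in let B := (b + A * K (fun z => z ^+ 3 / 6)) / s in
  exists e C, [/\ 0 < e, 0 <= C
    & forall x, X <= x -> `|u x - A * x - B| <= C * expR (- e * x)].
Proof.
move=> X0 d0 g0 P0 Q0 du dU1 dU2 ug Ug uPQ A B.
have cu := is_derive_continuous _ _ _ du.
have cU1 := is_derive_continuous _ _ _ dU1.
have cU2 := is_derive_continuous _ _ _ dU2.
pose r x := u x + (-1) * (A * x + B).
pose r1 x := u1 x + (-1) * A.
pose R1 x := U1 x + (- A) * (x ^+ 2 / 2) + (- B) * x.
pose R2 x := U2 x + (- A) * (x ^+ 3 / 6) + (- B) * (x ^+ 2 / 2).
have dr (x : R) : is_derive x 1 r (r1 x).
  by rewrite /r /r1; derive_tac; ring.
have dR1 (x : R) : is_derive x 1 R1 (r x).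
  by rewrite /R1 /r; derive_tac; rewrite /= expr1; field.
have dR2 (x : R) : is_derive x 1 R2 (R1 x).
  by rewrite /R1 /R2; derive_tac; rewrite /= expr1; field.
have cr := is_derive_continuous _ _ _ dr.
have cR2 := is_derive_continuous _ _ _ dR2.
have r_op x : compensated R K r r1 x = compensated R K u u1 x.
  rewrite (compensatedD _ _ _ pK)//; last by continuity.
  by rewrite compensated_affine mulr0 addr0.
have R2_op x : compensated R K R2 R1 x = compensated R K U2 U1 x - a * x - b.
  rewrite (compensatedD _ _ _ pK); [|by continuity..].
  rewrite (compensatedD _ _ _ pK); [|by continuity..].
  rewrite compensated_cube compensated_sqr /B /A; field.
  by rewrite gt_eqF.
have r_growth e : 0 < e ->
    exists C, forall x, X <= x -> `|r x| <= C * expR (e * x).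
  move=> e0; exists ((P + `|A|) / e + (Q + `|B|)) => x Xx.
  have x0 : 0 <= x := le_trans X0 Xx.
  have e1 : 1 <= expR (e * x).
    by rewrite -[leLHS]expR0 ler_expR mulr_ge0// ltW.
  have ex : x <= e^-1 * expR (e * x).
    by rewrite ler_pdivlMl//; have := expR_ge1Dx (e * x); lra.
  have A0 := normr_ge0 A; have B0 := normr_ge0 B.
  apply: (@le_trans _ _ ((P + `|A|) * x + (Q + `|B|))).
    rewrite /r mulN1r opprD addrA.
    apply: (le_trans (ler_normB _ _)).
    rewrite [leRHS](_ : _ = P * x + Q + `|A| * x + `|B|); last by ring.
    rewrite lerD2r; apply: (le_trans (ler_normB _ _)).
    by rewrite normrM (ger0_norm x0) lerD2r uPQ.
  rewrite [leRHS]mulrDl lerD//; last by rewrite ler_peMr// addr_ge0.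
  by rewrite -mulrA ler_wpM2l// addr_ge0.
have [|||e1 [C1 [e10 C10 rC1]]] := @barrier R L K pK L0 c0 s0 r r1 R1 R2 X d g
  X0 d0 g0 dr dR1 dR2.
- by move=> x Xx; rewrite r_op; have := ug x Xx; rewrite ler_norml => /andP[].
- by move=> x Xx; rewrite R2_op; have := Ug x Xx; rewrite ler_norml => /andP[].
- move=> e /r_growth[C rC]; exists C => x Xx.
  exact: le_trans (ler_norm _) (rC x Xx).
have dNr (x : R) : is_derive x 1 (fun t => - r t) (- r1 x) by derive_tac.
have dNR1 (x : R) : is_derive x 1 (fun t => - R1 t) (- r x) by derive_tac.
have dNR2 (x : R) : is_derive x 1 (fun t => - R2 t) (- R1 x) by derive_tac.
have [|||e2 [C2 [e20 C20 rC2]]] := @barrier R L K pK L0 c0 s0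
  (fun t => - r t) (fun t => - r1 t) (fun t => - R1 t) (fun t => - R2 t)
  X d g X0 d0 g0 dNr dNR1 dNR2.
- move=> x Xx; rewrite compensatedN// r_op lerN2; have := ug x Xx.
  by rewrite ler_norml => /andP[].
- move=> x Xx; rewrite compensatedN// R2_op lerNl; have := Ug x Xx.
  by rewrite ler_norml => /andP[].
- move=> e /r_growth[C rC]; exists C => x Xx.
  by apply: le_trans (rC x Xx); rewrite -normrN ler_norm.
exists (Num.min e1 e2), (C1 + C2); split; [by rewrite lt_min e10|exact: addr_ge0|].
move=> x Xx; have x0 : 0 <= x := le_trans X0 Xx.
have eE e : Num.min e1 e2 <= e -> expR (- e * x) <= expR (- Num.min e1 e2 * x).
  by move=> ee; rewrite ler_expR !mulNr lerN2 ler_wpM2r.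
have E1 : C1 * expR (- e1 * x) <= C1 * expR (- Num.min e1 e2 * x).
  by rewrite ler_wpM2l// eE// ge_min lexx.
have E2 : C2 * expR (- e2 * x) <= C2 * expR (- Num.min e1 e2 * x).
  by rewrite ler_wpM2l// eE// ge_min lexx orbT.
have p1 : 0 <= C1 * expR (- Num.min e1 e2 * x) by rewrite mulr_ge0 ?expR_ge0.
have p2 : 0 <= C2 * expR (- Num.min e1 e2 * x) by rewrite mulr_ge0 ?expR_ge0.
have := rC1 x Xx; have := rC2 x Xx; rewrite /r ler_norml; lra.
Qed.

(** [expR (- lam * x) * u x] stands for the wave, so the bound on [compensated R K u u1] expresses a
    quadratic nonlinearity. The local bound on [u1] permits differentiating
    [compensated R K U1 u]. *)
Theorem double_root_asymptotics (u u1 : R -> R) (lam CH Cf : R) :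
  0 < lam -> 0 < CH -> 0 <= Cf ->
  (forall x, 0 < u x) ->
  (forall x : R, is_derive x 1 u (u1 x)) ->
  (forall x, exists B : R, forall t, `|t - x| <= L + 1 -> `|u1 t| <= B) ->
  (forall x y, `|x - y| <= L -> u y <= CH * u x) ->
  (forall x, `|compensated R K u u1 x| <= Cf * (expR (- lam * x) * u x) * u x) ->
  (forall e, 0 < e -> exists X, forall x, X <= x -> expR (- lam * x) * u x <= e) ->
  exists A B e C X, [/\ 0 <= A, A = 0 -> 0 < B, 0 < e, 0 <= C
    & forall x, X <= x -> `|u x - A * x - B| <= C * expR (- e * x)].
Proof.
move=> lam0 CH0 Cf0 u0 du u1B harnack uf Wlim.
have Lp := L0; have sp := s0.
have cu := is_derive_continuous _ _ _ du.
have [U1 dU1] := continuous_primitive R u cu.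
have cU1 := is_derive_continuous _ _ _ dU1.
have [U2 dU2] := continuous_primitive R U1 cU1.
pose v := compensated R K U2 U1.
pose v1 := compensated R K U1 u.
pose v2 := compensated R K u u1.
have dv (x : R) : is_derive x 1 v (v1 x).
  have L10 : 0 <= L + 1 by lra.
  have [B uB] := continuous_locally_bounded R u x (L + 1) cu L10.
  exact: (is_derive_compensated _ _ _ pK _ _ _ _ B).
have dv1 (x : R) : is_derive x 1 v1 (v2 x).
  have [B uB] := u1B x.
  exact: (is_derive_compensated _ _ _ pK _ _ _ _ B).
(* [v] averages [u] over a window with weight [s], and the Harnack inequality bounds [u] on the
   window below by [u x / CH]. *)
have vu x : u x <= CH / s * v x.
  have vge : u x / CH * s <= v x.
    apply: (compensated_ge _ _ _ pK _ _ u) => // t tx.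
    by rewrite ler_pdivrMr// mulrC; exact: harnack.
  rewrite (_ : u x = CH / s * (u x / CH * s)) ?ler_pM2l ?divr_gt0//.
  by field; rewrite !gt_eqF.
have uv x : v x <= CH * u x * s.
  apply: (compensated_le _ _ _ pK _ _ u) => // t tx.
  by apply: harnack; rewrite distrC.
have CHs : 0 < CH / s by rewrite divr_gt0.
have v0 x : 0 < v x.
  by have := vu x; have := u0 x; have := CHs; nra.
pose W x := expR (- lam * x) * u x.
have W0 x : 0 < W x by rewrite mulr_gt0 ?expR_gt0.
(* With [u = O(expR (eta * x))] the wave is [O(expR (- (3 * eta) * x))], so the product of the two,
   which bounds [v2], decays at rate [d = 2 * eta]. *)
pose eta := lam / 4.
have eta0 : 0 < eta by rewrite divr_gt0.
pose C1 := Cf * (CH / s).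
have C10 : 0 <= C1 by rewrite mulr_ge0// ltW.
have v2W x : `|v2 x| <= C1 * W x * v x.
  apply: (le_trans (uf x)); rewrite -/(W x).
  rewrite (_ : C1 * W x * v x = Cf * W x * (CH / s * v x)); last by rewrite /C1; ring.
  by rewrite ler_wpM2l// mulr_ge0// ltW.
have [X1 [X10 WX1]] : exists X1, 0 <= X1 /\
    forall x, X1 <= x -> C1 * W x <= eta ^+ 2.
  have e0 : 0 < eta ^+ 2 / (C1 + 1) by rewrite divr_gt0 ?exprn_gt0//; lra.
  have [Y WY] := Wlim _ e0; exists (Num.max 0 Y).
  split; first by rewrite le_max lexx.
  move=> x; rewrite ge_max => /andP[_ Yx]; have := WY x Yx; rewrite -/(W x).
  rewrite ler_pdivlMr; last lra.
  by have := W0 x; nra.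
have [|C2 C20 vC2] := subexponential_growth R v v1 v2 dv dv1 v0 X1 eta X10 eta0.
  move=> x Xx; apply: le_trans (ler_norm _) (le_trans (v2W x) _).
  by rewrite ler_wpM2r ?WX1// ltW.
pose C3 := CH / s * C2.
have C30 : 0 <= C3 by rewrite mulr_ge0// ltW.
have uC3 x : X1 <= x -> u x <= C3 * expR (eta * x).
  move=> Xx; apply: (le_trans (vu x)).
  by rewrite /C3 -[leRHS]mulrA ler_pM2l//; exact: vC2.
pose d := 2 * eta.
have d0 : 0 < d by rewrite mulr_gt0.
have WC3 x : X1 <= x -> W x <= C3 * expR (- (3 * eta) * x).
  move=> Xx; rewrite /W mulrC -ler_pdivlMr ?expR_gt0// -expRN -mulrA -expRD.
  apply: (le_trans (uC3 x Xx)); rewrite le_eqVlt; apply/orP; left; apply/eqP.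
  by congr (_ * expR _); rewrite /eta; field.
have WC3' x : X1 <= x -> W x <= C3 * expR (- d * x).
  move=> Xx; apply: (le_trans (WC3 x Xx)); rewrite ler_wpM2l// ler_expR.
  have x0 : 0 <= x := le_trans X10 Xx.
  by rewrite ler_wpM2r// lerN2 ler_wpM2r// ?ltW//; lra.
pose C4 := Cf * C3 * C3.
have C40 : 0 <= C4 by rewrite mulr_ge0// mulr_ge0.
have v2C4 x : X1 <= x -> `|v2 x| <= C4 * expR (- d * x).
  move=> Xx; apply: (le_trans (uf x)); rewrite -/(W x).
  have A1 := WC3 x Xx; have A2 := uC3 x Xx.
  rewrite /C4 -2!mulrA -[leRHS]mulrA ler_wpM2l//.
  apply: (@le_trans _ _ (C3 * expR (- (3 * eta) * x) * (C3 * expR (eta * x)))).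
    by apply: ler_pM => //; exact: ltW.
  rewrite le_eqVlt; apply/orP; left; apply/eqP.
  rewrite (_ : - d * x = - (3 * eta) * x + eta * x); last by rewrite /d; ring.
  by rewrite expRD; ring.
have [a [b vab]] := linear_asymptotics R v v1 v2 dv dv1 X1 C4 d d0 C40 v2C4.
pose C5 := Num.max (C1 * C3) (Num.max (C4 / d) (C4 / d / d)).
have C50 : 0 <= C5 by rewrite le_max mulr_ge0.
have [C51 C52 C53] : [/\ C1 * C3 <= C5, C4 / d <= C5 & C4 / d / d <= C5].
  by rewrite /C5; split; rewrite !le_max lexx ?orbT.
have vb5 x : X1 <= x -> `|v x - a * x - b| <= C5 * expR (- d * x).
  move=> Xx; apply: (le_trans (vab x Xx).2).
  by rewrite ler_wpM2r ?expR_ge0.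
have [a0 ab] : 0 <= a /\ (a = 0 -> 0 < b).
  apply: (positive_asymptotics R v v1 v2 dv dv1 v0 X1 C5 d) => //.
  - move=> x Xx; apply: (le_trans (v2W x)); rewrite ler_wpM2r ?(ltW (v0 x))//.
    apply: (@le_trans _ _ (C1 * C3 * expR (- d * x))).
      by rewrite -mulrA ler_wpM2l// WC3'.
    by rewrite ler_wpM2r ?expR_ge0.
  - move=> x Xx; apply: (le_trans (vab x Xx).1).
    by rewrite ler_wpM2r ?expR_ge0.
pose g := Num.max C4 C5.
have g0 : 0 <= g by rewrite le_max C40.
(* Linear growth of [u], from [u <= CH / s * v] and the affine asymptotics of [v]. *)
pose P := CH / s * a; pose Q := CH / s * (`|b| + C5).
have P0 : 0 <= P by rewrite mulr_ge0// ltW.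
have Q0 : 0 <= Q by rewrite mulr_ge0 ?addr_ge0// ltW.
have [| | |e [C [e0 C0 rC]]] := deconvolution u u1 U1 U2 X1 d g a b P Q
  X10 d0 g0 P0 Q0 du dU1 dU2.
- move=> x Xx; apply: (le_trans (v2C4 x Xx)); rewrite ler_wpM2r ?expR_ge0//.
  by rewrite le_max lexx.
- move=> x Xx; apply: (le_trans (vb5 x Xx)); rewrite ler_wpM2r ?expR_ge0//.
  by rewrite le_max lexx orbT.
- move=> x Xx; rewrite gtr0_norm//; apply: (le_trans (vu x)).
  rewrite /P /Q -(mulrA _ a) -[leRHS]mulrDr ler_pM2l//.
  have x0 : 0 <= x := le_trans X10 Xx.
  have e1 : expR (- d * x) <= 1.
    rewrite -[leRHS]expR0 ler_expR mulNr oppr_le0.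
    by rewrite mulr_ge0// ltW.
  have := vb5 x Xx; have := ler_norm b; rewrite ler_norml; nra.
do 2 eexists; exists e, C, X1; split; [| |exact: e0|exact: C0|exact: rC].
- by rewrite divr_ge0// ltW.
- move=> /eqP; rewrite mulf_eq0 invr_eq0 (gt_eqF s0) orbF => /eqP a00.
  by rewrite a00 mul0r mul0r addr0 divr_gt0// ab.
Qed.

End DoubleRoot.

(** * The functional of a dispersal kernel *)

Section KernelFunctional.
Variable R : realType.
Notation mu := (@lebesgue_measure R).

Let reflect (a : R) : measurableTypeR R -> measurableTypeR R :=
  fun y : R => a - y.

Lemma measurable_reflect (a : R) : measurable_fun setT (reflect a).
Proof.
have cr : continuous (fun y : R => a - y) by continuity.
exact: continuous_measurable_fun cr.
Qed.

HB.instance Definition _ (a : R) :=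
  isMeasurableFun.Build _ _ _ _ (reflect a) (measurable_reflect a).

(** Lebesgue measure is determined by its values on intervals []x, y]], whose preimages [[a - y, a -
    x[] have the same length. *)
Lemma lebesgue_measure_reflect (a : R) (A : set (measurableTypeR R)) :
  measurable A -> pushforward mu (reflect a) A = mu A.
Proof.
move=> mA; apply/esym/lebesgue_measure_unique => //= _ [[x y]] _ <-.
rewrite /pushforward/= (_ : _ @^-1` _ = [set` `[a - y, a - x[]); last first.
  apply/seteqP; split => z /=; rewrite !in_itv/= /reflect => /andP[? ?];
    by apply/andP; split; lra.
rewrite !lebesgue_measure_itv/= !lte_fin.
by rewrite ltrD2l ltrN2; case: ifPn => // _; congr EFin; ring.
Qed.

Lemma integral_reflect (a : R) (h : R -> R) :
  mu.-integrable [set: R] (EFin \o h) ->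
  \int[mu]_y h (a - y) = \int[mu]_y h y.
Proof.
move=> ih; rewrite /Rintegral; congr fine.
have mh : measurable_fun [set: measurableTypeR R] (h : _ -> measurableTypeR R).
  by apply/measurable_EFinP; exact: measurable_int ih.
pose f (y : measurableTypeR R) := (h (reflect a y))%:E.
have mf : measurable_fun setT f.
  by apply/measurable_EFinP; exact: (measurableT_comp mh (measurable_reflect a)).
have hE : f \o reflect a = EFin \o h.
  by apply/funext => y /=; rewrite /f /reflect opprB addrC subrK.
have := @integral_pushforward _ _ _ _ R _ (measurable_reflect a) mu setT f mf.
rewrite hE preimage_setT => /(_ ih measurableT) <-.
by apply: eq_measure_integral => A mA _; apply/esym/lebesgue_measure_reflect.
Qed.

Variable J : R -> R.
Hypothesis hJ : dispersal_kernel J.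

Definition kernel_functional (phi : R -> R) : R := \int[mu]_z (J z * phi z).

Lemma kernel_support : exists2 L, 0 < L & forall z, J z != 0 -> `|z| <= L.
Proof.
have := compact_bounded (ker_supp hJ) => -[B [Br Bs]].
exists (`|B| + 1); first by rewrite ltr_wpDl.
move=> z Jz; apply: (Bs (`|B| + 1)).
  by rewrite (le_lt_trans (ler_norm B))// ltrDl.
exact: subset_closure.
Qed.

Lemma kernel_measurable : measurable_fun [set: measurableTypeR R] J.
Proof. by have := ker_meas hJ; exact. Qed.

(* The integral in [ker_int] lives on [R] with its default measurable structure,
   [kernel_functional] on [measurableTypeR R], which differs by its display. *)
Lemma kernel_integral : (\int[mu]_z (J z)%:E = 1)%E.
Proof.
pose phi : measurableTypeR R -> R := fun y => y.
have mphi : measurable_fun setT phi by move=> _ A mA; rewrite setTI.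
have mJ : measurable_fun [set: R] (EFin \o J).
  by apply/measurable_EFinP; exact: ker_meas hJ.
have := @ge0_integral_pushforward _ _ _ _ R phi mphi mu setT _ measurableT mJ.
move=> /(_ _)/esym JE; rewrite preimage_setT in JE.
rewrite JE; first exact: ker_int hJ.
by move=> z _; rewrite /= lee_fin (ker_ge0 hJ).
Qed.

Lemma kernel_integrable : mu.-integrable [set: R] (EFin \o J).
Proof.
apply/integrableP; split; first by apply/measurable_EFinP; exact: kernel_measurable.
under eq_integral => z _ do rewrite /= ger0_norm ?(ker_ge0 hJ)//.
by rewrite kernel_integral ltry.
Qed.

(** On the support of [J] the continuous function [phi] is bounded by some [B], so [B * J]
    dominates. *)
Lemma kernel_mul_integrable (phi : R -> R) : continuous phi ->
  mu.-integrable [set: R] (EFin \o (fun z => J z * phi z)).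
Proof.
move=> cphi; have [L L0 JL] := kernel_support.
have [B phiB] := continuous_locally_bounded R phi 0 L cphi (ltW L0).
have iB : mu.-integrable [set: R] (fun z => B%:E * (J z)%:E)%E.
  by apply: integrableZl => //; exact: kernel_integrable.
apply: le_integrable iB => //.
  apply/measurable_EFinP; apply: measurable_funM; first exact: kernel_measurable.
  exact: continuous_measurable_fun.
move=> z _ /=; rewrite lee_fin.
have [->|Jz] := eqVneq (J z) 0; first by rewrite mul0r mulr0.
rewrite !normrM mulrC ler_wpM2r//; apply: le_trans (ler_norm B).
by apply: phiB; rewrite subr0 JL.
Qed.

Lemma kernel_functional_positive (L : R) : (forall z, J z != 0 -> `|z| <= L) ->
  positive_functional R L kernel_functional.
Proof.
move=> JL; split.
- move=> f g cf cg; rewrite /kernel_functional -RintegralD//.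
  + by apply: eq_Rintegral => z _; rewrite mulrDr.
  + exact: kernel_mul_integrable.
  + exact: kernel_mul_integrable.
- move=> k f cf; rewrite /kernel_functional -RintegralZl//.
  + by apply: eq_Rintegral => z _; rewrite mulrCA.
  + exact: kernel_mul_integrable.
- move=> f g cf cg fg; apply: le_Rintegral => //.
  + exact: kernel_mul_integrable.
  + exact: kernel_mul_integrable.
  + move=> z _; have [->|Jz] := eqVneq (J z) 0; first by rewrite !mul0r.
    by rewrite ler_wpM2l ?(ker_ge0 hJ)// fg// JL.
Qed.

Lemma kernel_functional1 : kernel_functional (fun=> 1) = 1.
Proof.
rewrite /kernel_functional /Rintegral.
under eq_integral do rewrite mulr1.
by rewrite kernel_integral.
Qed.

Lemma kernel_functional_sym (phi : R -> R) : continuous phi ->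
  kernel_functional (fun z => phi (- z)) = kernel_functional phi.
Proof.
move=> cphi; rewrite /kernel_functional.
rewrite -(integral_reflect 0 (fun z => J z * phi z)); last exact: kernel_mul_integrable.
by apply: eq_Rintegral => z _; rewrite sub0r (ker_sym hJ).
Qed.

Lemma convolE (w : R -> R) (x : R) : continuous w ->
  convol J w x = kernel_functional (fun z => w (x - z)).
Proof.
move=> cw; rewrite /kernel_functional.
rewrite (_ : convol J w x = \int[mu]_y (J (x - y) * w y))//.
rewrite -(integral_reflect x (fun z => J z * w (x - z))); last first.
  by apply: kernel_mul_integrable; continuity.
by apply: eq_Rintegral => y _; rewrite subKr.
Qed.

(** A zero second moment would make [J z * z ^+ 2], hence [J], vanish almost everywhere, against
    total mass one. *)
Lemma kernel_functional_sqr_gt0 : 0 < kernel_functional (fun z => z ^+ 2).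
Proof.
have Jz2 z : 0 <= J z * z ^+ 2 by rewrite mulr_ge0 ?(ker_ge0 hJ) ?sqr_ge0.
rewrite lt_neqAle Rintegral_ge0 ?andbT//; apply/eqP => I0.
have iJ : mu.-integrable [set: R] (EFin \o (fun z => J z * z ^+ 2)).
  by apply: kernel_mul_integrable; continuity.
have mJ := measurable_int _ iJ.
have : (\int[mu]_z `|(EFin \o (fun z => (J z * z ^+ 2)%R)) z| = 0)%E.
  under eq_integral => z _ do rewrite /= ger0_norm//.
  move: I0; rewrite /kernel_functional /Rintegral => /esym I0.
  rewrite -[LHS]fineK ?I0//.
  exact: integrable_fin_num.
move=> /(ae_eq_integral_abs mu measurableT mJ) ae0.
have : (\int[mu]_z (J z)%:E = \int[mu]_(z in [set: R]) 0)%E.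
  apply: ae_eq_integral => //.
    by apply/measurable_EFinP; exact: kernel_measurable.
  have n0 : {ae mu, forall z : R, z != 0}.
    exists [set 0]; split => //; first exact: lebesgue_measure_set1.
    by move=> z /= /negP; rewrite negbK => /eqP.
  apply: filterS2 ae0 n0 => z + z0 _ => /(_ I)[] /eqP.
  by rewrite mulf_eq0 expf_eq0/= (negbTE z0) orbF => /eqP ->.
rewrite kernel_integral integral0 => /eqP.
by rewrite onee_eq0.
Qed.

End KernelFunctional.

(** * The nonlinearity near zero *)

Section Nonlinearity.
Variable R : realType.
Implicit Types (f : R -> R) (A : set R).

Lemma derive_on_approx A f (x e : R) : cvg (diffquo_on A f x) -> 0 < e ->
  exists2 d, 0 < d & forall y, A y -> `|y - x| < d ->
    `|f y - f x - derive_on A f x * (y - x)| <= e * `|y - x|.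
Proof.
move=> cf e0.
have cl : diffquo_on A f x --> derive_on A f x by [].
have /cvgrPdist_le/(_ e e0) := cl.
rewrite near_withinE near_withinE.
move=> /nbhs_ballP[d d0 dP]; exists d => // y Ay yx.
have [->|yx0] := eqVneq y x; first by rewrite !subrr mulr0 subr0 normr0 mulr0.
have := dP y; rewrite /= -ball_normE/= distrC => /(_ yx yx0 Ay).
have yxn : 0 < `|y - x| by rewrite normr_gt0 subr_eq0.
have -> : derive_on A f x - (f y - f x) / (y - x) =
    - (f y - f x - derive_on A f x * (y - x)) / (y - x).
  by field; rewrite subr_eq0.
by rewrite normrM normfV normrN ler_pdivrMr.
Qed.

Lemma derivable_on_continuous A f : derivable_on A f ->
  {within A, continuous f}.
Proof.
move=> df; apply/subspace_continuousP => x Ax.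
apply/cvgrPdist_le => e e0.
have [d d0 dP] := derive_on_approx A f x 1 (df x Ax) ltr01.
rewrite near_withinE; apply/nbhs_ballP.
set l := derive_on A f x in dP.
have l0 : 0 < `|l| + 1 by rewrite ltr_wpDl.
exists (Num.min d (e / (`|l| + 1))); first by rewrite /= lt_min d0 divr_gt0.
move=> y; rewrite -ball_normE/= lt_min distrC => /andP[yd ye] Ay.
have := dP y Ay yd; rewrite mul1r => H.
move: ye; rewrite ltr_pdivlMr// => ye.
have : `|f y - f x| <= `|f y - f x - l * (y - x)| + `|l * (y - x)|.
  by rewrite -[X in `|X| <= _](subrK (l * (y - x))); exact: ler_normD.
rewrite normrM distrC; have := normr_ge0 (y - x); lra.
Qed.

Lemma derivable_on_is_derive (a b : R) f : derivable_on `[a, b] f ->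
  forall x : R, a < x < b -> is_derive x 1 f (derive_on `[a, b] f x).
Proof.
move=> df x /andP[ax xb].
have xab : `[a, b]%classic x by rewrite /= in_itv/= !ltW.
have cv : h^-1 *: (f (h *: 1 + x) - f x) @[h --> 0^'] --> derive_on `[a, b] f x.
  apply/cvgrPdist_le => e e0.
  have [d d0 dP] := derive_on_approx `[a, b] f x e (df x xab) e0.
  near=> h.
  have h0 : h != 0 by near: h; exact: nbhs_dnbhs_neq.
  have hn : 0 < `|h| by rewrite normr_gt0.
  have : `|h| < Num.min d (Num.min (x - a) (b - x)).
    by near: h; apply: dnbhs0_lt; rewrite !lt_min d0 !subr_gt0 ax.
  rewrite !lt_min => /and3P[hd]; rewrite !ltr_norml => /andP[h1 h2] /andP[h3 h4].
  have := dP (h + x); rewrite addrK => /(_ _ hd) H.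
  have : `|f (h + x) - f x - derive_on `[a, b] f x * h| <= e * `|h|.
    by apply: H; rewrite /= in_itv/=; lra.
  rewrite /GRing.scale/= mulr1.
  have -> : derive_on `[a, b] f x - h^-1 * (f (h + x) - f x) =
    - (f (h + x) - f x - derive_on `[a, b] f x * h) / h by field.
  by rewrite normrM normfV normrN ler_pdivrMr.
by apply: DeriveDef; [apply/cvg_ex; eexists; exact: cv|exact/cvg_lim].
Unshelve. all: by end_near. Qed.

(** Differentiability of [f'] at [0] gives [|f' y - f' 0| <= D * y] nearby, and the mean value
    theorem gains one more power of [w]. Away from [0] a constant bound is already quadratic. *)
Lemma quadratic_remainder f : derivable_on `[0, 1] f ->
  derivable_on `[0, 1] (deriv01 f) -> f 0 = 0 ->
  exists2 C, 0 <= C & forall w, 0 < w < 1 ->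
    `|f w - deriv01 f 0 * w| <= C * w ^+ 2.
Proof.
move=> df ddf f0.
have i0 : `[0, 1]%classic (0 : R) by rewrite /= in_itv/= lexx ler01.
set k := deriv01 f 0.
have [d1 d10 d1P] := derive_on_approx `[0, 1] f 0 1 (df 0 i0) ltr01.
have [d2 d20 d2P] := derive_on_approx `[0, 1] (deriv01 f) 0 1 (ddf 0 i0) ltr01.
set k2 := derive_on `[0, 1] (deriv01 f) 0 in d2P.
pose D := `|k2| + 1.
have D0 : 0 <= D by rewrite addr_ge0.
have dk y : 0 < y < 1 -> y < d2 -> `|deriv01 f y - k| <= D * y.
  move=> /andP[y0 y1] yd; have yn : `|y - 0| = y by rewrite subr0 gtr0_norm.
  have := d2P y; rewrite yn mul1r subr0 => /(_ _ yd) H.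
  have {}H : `|deriv01 f y - deriv01 f 0 - k2 * y| <= y.
    by apply: H; rewrite /= in_itv/= !ltW.
  rewrite -[X in `|X| <= _](subrK (k2 * y)) /D mulrDl mul1r.
  apply: le_trans (ler_normD _ _) _; rewrite [leRHS]addrC lerD//.
  by rewrite normrM (gtr0_norm y0).
have small w : 0 < w < 1 -> w < d2 -> `|f w - k * w| <= D * w ^+ 2.
  move=> /andP[w0 w1] wd; apply/ler_addgt0Pr => e e0.
  (* The mean value theorem is applied on [[t, w]], inside the open interval where the derivative is
     two-sided; the error at [t] is at most [e]. *)
  pose t := Num.min (w / 2) (Num.min (d1 / 2) e).
  have t0 : 0 < t by rewrite /t !lt_min e0 !divr_gt0.
  have [tw td te] : [/\ t <= w / 2, t <= d1 / 2 & t <= e].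
    by rewrite /t; split; rewrite !ge_min lexx ?orbT.
  have tw' : t <= w by lra.
  have ft : `|f t - k * t| <= t.
    have tn : `|t - 0| = t by rewrite subr0 gtr0_norm.
    have := d1P t; rewrite tn mul1r subr0 f0 subr0; apply; last lra.
    by rewrite /= in_itv/=; lra.
  have dG y : t <= y <= w -> is_derive y 1 (fun y => f y - k * y) (deriv01 f y - k).
    move=> /andP[ty yw].
    have dfy : is_derive y 1 f (deriv01 f y).
      by apply: derivable_on_is_derive => //; lra.
    by derive_tac; rewrite mulr1.
  have [y /andP[ty yw] yE] := mean_value R (fun y => f y - k * y)
    (fun y => deriv01 f y - k) t w tw' dG.
  have dky : `|deriv01 f y - k| <= D * y by apply: dk; lra.
  have : `|(f w - k * w) - (f t - k * t)| <= D * w ^+ 2.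
    rewrite yE normrM (_ : `|w - t| = w - t); last by rewrite ger0_norm//; lra.
    have wt0 : 0 <= w - t by lra.
    apply: (le_trans (ler_wpM2r wt0 dky)); rewrite expr2 mulrA.
    by apply: ler_pM; [rewrite mulr_ge0//; lra|lra|rewrite ler_wpM2l|lra].
  have := ler_normD ((f w - k * w) - (f t - k * t)) (f t - k * t).
  rewrite subrK; lra.
have [|m _ mP] := @EVT_max R (fun w => `|f w - k * w|) 0 1 ler01.
  have cf := derivable_on_continuous _ _ df.
  have ck : {within `[0, 1], continuous (fun w : R => k * w)}.
    by apply: continuous_subspaceT; continuity.
  by move=> x; apply: cvg_norm; apply: cvgB; [exact: cf|exact: ck].
set B := `|f m - k * m| in mP.
have B0 : 0 <= B by exact: normr_ge0.
exists (D + B / d2 ^+ 2); first by rewrite addr_ge0// divr_ge0// sqr_ge0.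
move=> w w01; have [wd|wd] := ltP w d2.
  apply: (le_trans (small w w01 wd)); rewrite [leRHS]mulrDl lerDl.
  by rewrite mulr_ge0 ?sqr_ge0// divr_ge0// sqr_ge0.
move: w01 => /andP[w0 w1].
have wB : `|f w - k * w| <= B by apply: mP; rewrite in_itv/= !ltW.
apply: (le_trans wB); rewrite [leRHS]mulrDl ler_wpDl//; first by rewrite mulr_ge0 ?sqr_ge0.
rewrite mulrAC ler_pdivlMr ?exprn_gt0// ler_wpM2l//.
by rewrite lerXn2r ?nnegrE ?(ltW d20) ?(ltW w0).
Qed.

End Nonlinearity.

(** * Traveling waves *)

Section Wave.
Variables (R : realType) (J f W : R -> R) (c lam : R).
Hypotheses (hJ : dispersal_kernel J) (hf : monostable f)
  (hW : traveling_wave J f c W).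

Notation I := (kernel_functional R J).

Definition exp_kernel_functional (phi : R -> R) : R :=
  I (fun z => expR (lam * z) * phi z).

Notation K := exp_kernel_functional.

Lemma kernel_functional_id : I (fun z => z) = 0.
Proof.
have [L L0 JL] := kernel_support R J hJ.
have pI := kernel_functional_positive R J hJ L JL.
have := kernel_functional_sym R J hJ (fun z => z).
move=> /(_ (@continuous_idfun R)).
rewrite (_ : (fun z : R => - z) = fun z => -1 * z); last first.
  by apply/funext => z; rewrite mulN1r.
rewrite (pf_scale _ _ _ pI); [lra|by continuity].
Qed.

(** On the support [z ^+ 2 <= L * |z|], and by symmetry the positive and negative parts of [z]
    contribute equally to the moment of [|z|]. *)
Lemma kernel_functional_pos_gt0 : 0 < I (fun z => Num.max z 0).
Proof.
have [L L0 JL] := kernel_support R J hJ.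
have pI := kernel_functional_positive R J hJ L JL.
have I2 := kernel_functional_sqr_gt0 R J hJ.
have cm : continuous (fun z : R => Num.max z 0) by continuity.
have cmN : continuous (fun z : R => Num.max (- z) 0) by continuity.
have : I (fun z => z ^+ 2) <= I (fun z => L * (Num.max z 0 + Num.max (- z) 0)).
  apply: (pf_le _ _ _ pI); [by continuity|by continuity|move=> z].
  rewrite ler_norml => zL; rewrite !maxEle; case: ifPn; case: ifPn; rewrite -?ltNge.
  - by move=> ? ?; nra.
  - by move=> ? ?; nra.
  - by move=> ? ?; nra.
  - by move=> ? ?; nra.
rewrite (pf_scale _ _ _ pI) ?(pf_add _ _ _ pI); [|by continuity..].
rewrite (kernel_functional_sym R J hJ (fun z => Num.max z 0) cm).
nra.
Qed.

Lemma quadratic_ge0_eq0 (a Q r : R) : 0 < r -> 0 <= Q ->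
  (forall e, `|e| <= r -> 0 <= e * a + e ^+ 2 * Q) -> a = 0.
Proof.
move=> r0 Q0 H; apply/eqP; apply: contraT => a0.
have an : 0 < `|a| by rewrite normr_gt0.
(* At [e = - (t * a)] the expression equals [t * a ^+ 2 * (t * Q - 1)], negative as soon as
   [t * (Q + 1) <= 1]. *)
pose t := Num.min (r / `|a|) (Q + 1)^-1.
have Q1 : 0 < Q + 1 by lra.
have t0 : 0 < t by rewrite lt_min divr_gt0// invr_gt0.
have [ta tQ] : t <= r / `|a| /\ t <= (Q + 1)^-1.
  by rewrite /t; split; rewrite ge_min lexx ?orbT.
have := H (- (t * a)); rewrite normrN normrM (gtr0_norm t0) -ler_pdivlMr//.
move=> /(_ ta).
have tQ1 : t * (Q + 1) <= 1 by rewrite -ler_pdivlMr// div1r.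
have a2 : 0 < a ^+ 2 by rewrite exprn_even_gt0.
rewrite (_ : - (t * a) * a + _ = t * a ^+ 2 * (t * Q - 1)); last by ring.
rewrite (pmulr_rge0 _ (mulr_gt0 t0 a2)) => tQ2; exfalso; nra.
Qed.

(** * Consequences of the minimality of the linear speed *)

Section LinearSpeed.
Hypotheses (lam0 : 0 < lam) (hc : is_linear_speed J f c)
  (hh : hfun J f lam = c * lam).

Let hfunE (l : R) : hfun J f l = I (fun z => expR (l * z)) - 1 + deriv01 f 0.
Proof. by []. Qed.

(** [J] has zero mean, so [expR y >= 1 + y] makes its exponential moment at least [1]; hence
    [c * lam] is at least [deriv01 f 0 > 0]. *)
Lemma linear_speed_gt0 : 0 < c.
Proof.
have [L L0 JL] := kernel_support R J hJ.
have pI := kernel_functional_positive R J hJ L JL.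
have : I (fun z => 1 + lam * z) <= I (fun z => expR (lam * z)).
  apply: (pf_le _ _ _ pI); [by continuity|by continuity|move=> z _].
  exact: expR_ge1Dx.
rewrite (pf_add _ _ _ pI) ?(pf_scale _ _ _ pI); [|by continuity..].
rewrite kernel_functional1// kernel_functional_id mulr0 addr0 => I1.
have := mono_df0 hf; move: hh; rewrite hfunE => hhE k0.
have : 0 < c * lam by rewrite -hhE; lra.
by rewrite pmulr_lgt0.
Qed.

Lemma exp_kernel_positive (L : R) : (forall z, J z != 0 -> `|z| <= L) ->
  positive_functional R L K.
Proof.
move=> JL; have pI := kernel_functional_positive R J hJ L JL.
split; rewrite /K.
- move=> g h cg ch; rewrite -(pf_add _ _ _ pI); [|by continuity..].
  by congr I; apply/funext => z; rewrite mulrDr.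
- move=> k g cg; rewrite -(pf_scale _ _ _ pI); last by continuity.
  by congr I; apply/funext => z; rewrite mulrCA.
- move=> g h cg ch gh; apply: (pf_le _ _ _ pI); [by continuity|by continuity|].
  by move=> z zL; rewrite ler_pM2l ?expR_gt0// gh.
Qed.

Lemma exp_kernel_sqr_gt0 : 0 < K (fun z => z ^+ 2 / 2).
Proof.
have [L L0 JL] := kernel_support R J hJ.
have pI := kernel_functional_positive R J hJ L JL.
apply: (@lt_le_trans _ _ (expR (- lam * L) / 2 * I (fun z => z ^+ 2))).
  by rewrite mulr_gt0 ?kernel_functional_sqr_gt0// divr_gt0// expR_gt0.
rewrite -(pf_scale _ _ _ pI); last by continuity.
apply: (pf_le _ _ _ pI); [by continuity|by continuity|move=> z].
rewrite ler_norml => /andP[zL _].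
rewrite -mulrA (mulrC 2^-1) ler_wpM2r ?divr_ge0 ?sqr_ge0// ler_expR.
by rewrite mulNr -mulrN ler_pM2l.
Qed.

(* First-order condition for the minimum of [h(l)/l] at [lam]. *)
Lemma linear_speed_first_moment : K (fun z => z) = c.
Proof.
have [L L0 JL] := kernel_support R J hJ.
have pK := exp_kernel_positive L JL.
have s0 := exp_kernel_sqr_gt0.
have hK (l : R) : I (fun z => expR ((lam + l) * z)) = K (fun z => expR (l * z)).
  by congr I; apply/funext => z; rewrite -expRD mulrDl.
have h0 : I (fun z => expR (lam * z)) = K (fun=> 1).
  by congr I; apply/funext => z; rewrite mulr1.
(* The radius [lam / 2] keeps [lam + e] positive, and [1] keeps [|e * z| <= L], where the
   exponential is at most [expR L]. *)
have l2 : 0 < Num.min 1 (lam / 2) by rewrite lt_min ltr01 divr_gt0.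
apply/eqP; rewrite -subr_eq0; apply/eqP.
apply: (quadratic_ge0_eq0 _ (expR L * K (fun z => z ^+ 2 / 2)) _ l2).
  by rewrite mulr_ge0 ?expR_ge0// ltW.
move=> e; rewrite le_min => /andP[e1 el].
have le0 : 0 < lam + e by move: el lam0; rewrite ler_norml; lra.
have cle : c * (lam + e) <= hfun J f (lam + e).
  rewrite -ler_pdivlMr//; apply: hc.2.
  by exists (lam + e).
have Ke : K (fun z => expR (e * z)) <=
    K (fun z => 1 + e * z + expR L * e ^+ 2 * (z ^+ 2 / 2)).
  apply: (pf_le _ _ _ pK); [by continuity|by continuity|move=> z zL].
  have ezL : `|- (e * z)| <= L.
    by rewrite normrN normrM -[leRHS]mul1r ler_pM.
  have expd (t : R) : is_derive t 1 (@expR R) (expR t) by exact: is_derive_expR.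
  have := @taylor2_le R expR expR expR L 0 (expR L) (- (e * z)) expd expd _ ezL.
  rewrite sub0r opprK expR0 sqrrN exprMn => /(_ _) H.
  have : expR (e * z) - 1 + - (e * z) * 1 <= expR L * (e ^+ 2 * z ^+ 2 / 2).
    apply: H => t; rewrite subr0 ler_norml => /andP[_ tL].
    by rewrite ler_expR.
  lra.
move: Ke; rewrite !(pf_add _ _ _ pK) ?(pf_scale _ _ _ pK); [|by continuity..].
move: cle hh; rewrite !hfunE hK h0; nra.
Qed.

End LinearSpeed.

(** * Monotonicity and bounds of the wave profile *)

Let dW (x : R) : is_derive x 1 W (derive1 W x).
Proof. by rewrite derive1E; apply: DeriveDef => //; exact: tw_derivable hW x. Qed.

Let cW : continuous W.
Proof. exact: is_derive_continuous dW. Qed.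

Lemma wave_decreasing (x y : R) : x < y -> W y < W x.
Proof.
move=> xy; have [t _ E] := mean_value R W _ x y (ltW xy) (fun t _ => dW t).
by have := tw_decr hW t; nra.
Qed.

Lemma wave_nonincreasing (x y : R) : x <= y -> W y <= W x.
Proof. by rewrite le_eqVlt => /predU1P[->//|/wave_decreasing/ltW]. Qed.

Lemma wave_pinfty (e : R) : 0 < e -> exists X, forall x, X <= x -> `|W x| <= e.
Proof.
move=> e0; have /cvgrPdist_le/(_ e e0)[X [Xr XP]] := tw_pinfty hW.
exists (X + 1) => x Xx; have Xx' : X < x by lra.
by have := XP x Xx'; rewrite sub0r normrN.
Qed.

Lemma wave_ninfty (e : R) : 0 < e -> exists X, forall x, x <= X -> `|1 - W x| <= e.
Proof.
move=> e0; have /cvgrPdist_le/(_ e e0)[X [Xr XP]] := tw_ninfty hW.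
by exists (X - 1) => x Xx; apply: XP; lra.
Qed.

Lemma wave_gt0 (x : R) : 0 < W x.
Proof.
rewrite ltNge; apply/negP => Wx.
have W1 : W (x + 1) < W x by apply: wave_decreasing; lra.
have e0 : 0 < - W (x + 1) / 2 by lra.
have [X XP] := wave_pinfty _ e0.
have := XP _ (_ : X <= Num.max X (x + 1)); rewrite le_max lexx => /(_ isT).
have : W (Num.max X (x + 1)) <= W (x + 1).
  by apply: wave_nonincreasing; rewrite le_max lexx orbT.
rewrite ler_norml; lra.
Qed.

Lemma wave_lt1 (x : R) : W x < 1.
Proof.
rewrite ltNge; apply/negP => Wx.
have W1 : W x < W (x - 1) by apply: wave_decreasing; lra.
have e0 : 0 < (W (x - 1) - 1) / 2 by lra.
have [X XP] := wave_ninfty _ e0.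
have := XP _ (_ : Num.min X (x - 1) <= X); rewrite ge_min lexx => /(_ isT).
have : W (x - 1) <= W (Num.min X (x - 1)).
  by apply: wave_nonincreasing; rewrite ge_min lexx orbT.
rewrite ler_norml; lra.
Qed.

Lemma wave_eq (x : R) :
  I (fun z => W (x - z)) + c * derive1 W x + f (W x) - W x = 0.
Proof. by rewrite -convolE// (tw_eq hW). Qed.

(** * Harnack inequality and derivative bound for the wave *)

Hypothesis c0 : 0 < c.

(* On [x, x+b] the nonlocal term feeds from the left, [J * W >= th W(x - b)],
   while [W] remains positive on the whole interval. *)
Lemma wave_harnack_step : exists b k, [/\ 0 < b, 0 < k
  & forall x, W (x - b) <= k * W x].
Proof.
have [L L0 JL] := kernel_support R J hJ.
have pI := kernel_functional_positive R J hJ L JL.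
have p0 := kernel_functional_pos_gt0.
(* Since [max (z - a) 0 >= max z 0 - a] and the mass is [1], half of the positive moment survives
   the shift by [a]. *)
pose a := I (fun z => Num.max z 0) / 2.
have a0 : 0 < a by rewrite divr_gt0.
have Ia : a <= I (fun z => Num.max (z - a) 0).
  have aE : I (fun z => Num.max z 0 + - a * 1) = a.
    rewrite (pf_add _ _ _ pI) ?(pf_scale _ _ _ pI); [|by continuity..].
    by rewrite kernel_functional1// /a; field.
  rewrite -[leLHS]aE.
  apply: (pf_le _ _ _ pI); [by continuity|by continuity|move=> z _].
  rewrite mulr1 le_max; case: (leP z 0) => z0; apply/orP; [right|by left].
  by rewrite add0r oppr_le0 ltW.
(* If [z > a] and [t <= x + b], then [t - z <= x - b], where [W] is at least [W (x - b)]. Dividing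
   by [L] turns [max (z - a) 0] into a weight at most [1] on the support. *)
pose b := a / 2; pose th := a / L.
have b0 : 0 < b by rewrite divr_gt0.
have th0 : 0 < th by rewrite divr_gt0.
have feed x t : x <= t <= x + b -> th * W (x - b) <= I (fun z => W (t - z)).
  move=> /andP[xt tx]; have w0 := wave_gt0 (x - b).
  apply: (@le_trans _ _ (I (fun z => W (x - b) / L * Num.max (z - a) 0))).
    rewrite (pf_scale _ _ _ pI); last by continuity.
    rewrite (_ : th * W (x - b) = W (x - b) / L * a); last by rewrite /th; ring.
    by rewrite ler_pM2l// divr_gt0.
  apply: (pf_le _ _ _ pI); [by continuity|by continuity|move=> z].
  rewrite ler_norml => /andP[_ zL]; case: (leP (z - a) 0) => za.
    by rewrite mulr0 ltW// wave_gt0.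
  apply: (@le_trans _ _ (W (x - b))); last first.
    by apply: wave_nonincreasing; rewrite /b in tx *; lra.
  rewrite -mulrA ger_pMr// mulrC ler_pdivrMr//; lra.
(* Dropping [c * W (x + b) > 0] from the integrated inequality leaves
   [b * th * W (x - b) <= (c + b) * W x]. *)
pose k := (c + b) / (b * th).
exists b, k; split => //; first exact: divr_gt0 (addr_gt0 c0 b0) (mulr_gt0 b0 th0).
move=> x; have xb : x <= x + b by lra.
have [t /andP[xt tx] E] := mean_value R W _ x (x + b) xb (fun t _ => dW t).
have := wave_eq t; have := feed x t; rewrite xt tx => /(_ isT) Ft eqt.
have fW : 0 < f (W t) by apply: (mono_gt0 hf); rewrite wave_gt0 wave_lt1.
have Wt : W t <= W x by exact: wave_nonincreasing.
have Wb := wave_gt0 (x + b).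
rewrite /k mulrAC (ler_pdivlMr _ _ (mulr_gt0 b0 th0)).
have A1 : c * derive1 W t <= W x - th * W (x - b) by lra.
have A2 : c * (W (x + b) - W x) <= (W x - th * W (x - b)) * b.
  rewrite E (_ : x + b - x = b); last by ring.
  by rewrite mulrA ler_pM2r.
have A3 : 0 < c * W (x + b) by rewrite mulr_gt0.
lra.
Qed.

(** The step is iterated until [n * b] exceeds [L]; monotonicity of [W] covers all points to the
    right of [x - L]. *)
Lemma wave_harnack (L : R) : exists2 k, 0 < k &
  forall x y, x - L <= y -> W y <= k * W x.
Proof.
have [b [k [b0 k0 Wk]]] := wave_harnack_step.
have iter n x : W (x - n%:R * b) <= k ^+ n * W x.
  elim: n x => [|n IH] x; first by rewrite mul0r subr0 expr0 mul1r.
  apply: (@le_trans _ _ (k ^+ n * W (x - b))).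
    by apply: le_trans (IH (x - b)); rewrite -natr1 mulrDl mul1r opprD addrA addrAC.
  by rewrite exprSr -mulrA ler_pM2l// exprn_gt0.
pose n := Num.bound `|L / b|.
have nL : L <= n%:R * b.
  rewrite -ler_pdivrMr//; apply: le_trans (ler_norm _) _.
  exact/ltW/archi_boundP/normr_ge0.
exists (k ^+ n); first exact: exprn_gt0.
move=> x y xy; apply: le_trans (iter n x); apply: wave_nonincreasing; lra.
Qed.

(** The wave equation gives [c * W'] in terms of quantities that are bounded because [0 < W < 1]. *)
Lemma wave_derive_bounded : exists B, forall x, `|derive1 W x| <= B.
Proof.
have [L L0 JL] := kernel_support R J hJ.
have pI := kernel_functional_positive R J hJ L JL.
have [df ddf _] := mono_C2 hf.
have [C C0 fC] := quadratic_remainder R f df ddf (mono_f0 hf).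
pose k := deriv01 f 0.
exists ((2 + `|k| + C) / c) => x.
rewrite ler_pdivlMr// mulrC -(gtr0_norm c0) -normrM.
have W0 := wave_gt0 x; have W1 := wave_lt1 x.
have I0 : `|I (fun z => W (x - z))| <= 1 * I (fun=> 1).
  apply: (pf_norm_le _ _ _ pI); first by have cW' := cW; continuity.
  by move=> z _; rewrite gtr0_norm ?wave_gt0// ltW// wave_lt1.
rewrite kernel_functional1// mulr1 in I0.
have fW : `|f (W x) - k * W x| <= C * W x ^+ 2 by apply: fC; rewrite W0 W1.
have kW : `|k * W x| <= `|k|.
  by rewrite normrM (gtr0_norm W0) ler_piMr// ltW.
have CW : C * W x ^+ 2 <= C.
  by rewrite ler_piMr// expr_le1// ltW.
have -> : c * derive1 W x = - I (fun z => W (x - z)) - (f (W x) - k * W x)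
    - k * W x + W x.
  by have := wave_eq x; lra.
move: I0 fW kW; rewrite !ler_norml; lra.
Qed.

End Wave.

(** * From exponential remainders to the Landau form, and the conclusion *)

Lemma eqaddo_exp (R : realType) (W g : R -> R) (lam e C X : R) : 0 < e ->
  (forall x, X <= x -> `|W x - g x| <= C * expR (- e * x) * expR (- lam * x)) ->
  forall xi, W xi = g xi +o_(xi \near +oo) expR (- lam * xi).
Proof.
move=> e0 Wg.
have E : W = g +o_ (pinfty_filter_on R) (fun xi => expR (- lam * xi)).
  apply/eqaddoP => eps eps0.
  have [Y _ YP] := exp_le_eventually R C e eps e0 eps0.
  exists (Num.max X Y); split; first exact: num_real.
  move=> x; rewrite gt_max => /andP[/ltW Xx /ltW Yx].
  rewrite [X in _ * X]ger0_norm ?expR_ge0//; apply: (le_trans (Wg x Xx)).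
  by rewrite ler_wpM2r ?expR_ge0// YP.
by move=> xi; have := congr1 (@^~ xi) E.
Qed.

Theorem proposition3p3 (R : realType) (Q : Type)
  (J : R -> R) (f : Q -> R -> R) (q : Q)
  (cNL c0 lambda0 : R) (W : R -> R)
  (hJ : dispersal_kernel J)
  (hf : monostable (f q))
  (hcNL : is_minimal_speed J (f q) cNL)
  (hW : traveling_wave J (f q) cNL W)
  (hc0 : is_linear_speed J (f q) c0)
  (hlambda0 : 0 < lambda0)
  (hh : hfun J (f q) lambda0 = c0 * lambda0)
  (hlin : cNL = c0) :
  exists A B : R,
    [/\ 0 <= A,
        (A = 0 -> 0 < B)
      & forall xi : R,
        W xi = (A * xi * expR (- lambda0 * xi) + B * expR (- lambda0 * xi))
          +o_(xi \near +oo) expR (- lambda0 * xi)].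
Proof.
clear hcNL; subst cNL.
have c_gt0 := linear_speed_gt0 _ _ _ _ _ hJ hf hlambda0 hh.
have [L L0 JL] := kernel_support R J hJ.
pose K := exp_kernel_functional R J lambda0.
have pK : positive_functional R L K by exact: exp_kernel_positive.
have s0 : 0 < K (fun z => z ^+ 2 / 2) by exact: exp_kernel_sqr_gt0.
have Kc : K (fun z => z) = c0.
  exact: (linear_speed_first_moment _ _ _ _ _ hJ hlambda0 hc0 hh).
have Kc0 : 0 < K (fun z => z) by rewrite Kc.
have [k1 k10 hk1] := wave_harnack _ _ _ _ _ hJ hf hW c_gt0 L.
have [BW hBW] := wave_derive_bounded _ _ _ _ _ hJ hf hW c_gt0.
have W0 := wave_gt0 _ _ _ _ _ hW; have W1 := wave_lt1 _ _ _ _ _ hW.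
have Weq := wave_eq _ _ _ _ _ hJ hW.
have [df ddf _] := mono_C2 hf.
have [C C0 fC] := quadratic_remainder R (f q) df ddf (mono_f0 hf).
have dW (x : R) : is_derive x 1 W (derive1 W x).
  by rewrite derive1E; apply: DeriveDef => //; exact: tw_derivable hW x.
have cW := is_derive_continuous _ _ _ dW.
pose u x := expR (lambda0 * x) * W x.
pose u1 x := lambda0 * expR (lambda0 * x) * W x + expR (lambda0 * x) * derive1 W x.
have du (x : R) : is_derive x 1 u (u1 x) by rewrite /u /u1; derive_tac.
have cu := is_derive_continuous _ _ _ du.
have uW x : expR (- lambda0 * x) * u x = W x.
  by rewrite /u mulrA -expRD mulNr addNr expR0 mul1r.
have u_gt0 x : 0 < u x by rewrite mulr_gt0 ?expR_gt0.
have BW0 : 0 <= BW by exact: le_trans (normr_ge0 _) (hBW 0).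
have u1B x : exists B : R, forall t, `|t - x| <= L + 1 -> `|u1 t| <= B.
  exists (expR (lambda0 * (x + (L + 1))) * (lambda0 + BW)) => t.
  rewrite ler_norml => /andP[_ tx].
  rewrite (_ : u1 t = expR (lambda0 * t) * (lambda0 * W t + derive1 W t)); last first.
    by rewrite /u1; ring.
  rewrite normrM ger0_norm ?expR_ge0// ler_pM ?expR_ge0//.
    by rewrite ler_expR ler_pM2l//; lra.
  apply: (le_trans (ler_normD _ _)); rewrite lerD//.
  by rewrite normrM !gtr0_norm// ler_piMr ?ltW.
(* The exponential weights at [x] and [y] differ by a factor of at most [expR (lambda0 * L)]. *)
have harnack x y : `|x - y| <= L -> u y <= expR (lambda0 * L) * k1 * u x.
  rewrite ler_norml => xy.
  rewrite /u (_ : expR (lambda0 * L) * k1 * (expR (lambda0 * x) * W x) =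
    (expR (lambda0 * L) * expR (lambda0 * x)) * (k1 * W x)); last by ring.
  apply: ler_pM; [exact: expR_ge0|exact: ltW| |by apply: hk1; lra].
  by rewrite -expRD ler_expR -mulrDr ler_pM2l//; lra.
(* The mass of [K] follows from [hh] and its first moment is [c0], so all linear terms cancel. Only
   the quadratic remainder of [f q] at [W x], times [- expR (lambda0 * x)], is left. *)
have u_op x : `|compensated R K u u1 x| <= C * (expR (- lambda0 * x) * u x) * u x.
  rewrite uW (compensatedE _ _ _ pK)// Kc.
  have -> : K (fun z => u (x - z)) =
      expR (lambda0 * x) * kernel_functional R J (fun z => W (x - z)).
    have pI := kernel_functional_positive R J hJ L JL.
    rewrite -(pf_scale _ _ _ pI); last by continuity.
    congr kernel_functional; apply/funext => z.
    by rewrite /u mulrA -expRD; congr (expR _ * _); ring.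
  have -> : K (fun=> 1) = c0 * lambda0 + 1 - deriv01 (f q) 0.
    have K1 : K (fun=> 1) = kernel_functional R J (fun z => expR (lambda0 * z)).
      by congr kernel_functional; apply/funext => z; rewrite mulr1.
    rewrite K1; move: hh.
    rewrite (_ : hfun J (f q) lambda0 =
      kernel_functional R J (fun z => expR (lambda0 * z)) - 1 + deriv01 (f q) 0)//.
    by lra.
  rewrite (_ : _ + _ = - (expR (lambda0 * x)
    * (f q (W x) - deriv01 (f q) 0 * W x))); last first.
    have {}Weq : kernel_functional R J (fun z => W (x - z)) =
        W x - f q (W x) - c0 * derive1 W x by have := Weq x; lra.
    by rewrite Weq /u /u1; ring.
  rewrite normrN normrM ger0_norm ?expR_ge0//.
  rewrite (_ : C * W x * u x = expR (lambda0 * x) * (C * W x ^+ 2)).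
    by rewrite ler_pM2l ?expR_gt0//; apply: fC; rewrite W0 W1.
  by rewrite /u; ring.
have ulim e : 0 < e ->
    exists X, forall x, X <= x -> expR (- lambda0 * x) * u x <= e.
  move=> e0; have [X XP] := wave_pinfty _ _ _ _ _ hW e e0.
  by exists X => x Xx; rewrite uW; exact: le_trans (ler_norm _) (XP x Xx).
have CH0 : 0 < expR (lambda0 * L) * k1 by rewrite mulr_gt0 ?expR_gt0.
have [A [B [e [C' [X [A0 AB e0 C'0 uAB]]]]]] := double_root_asymptotics R L K pK
  L0 Kc0 s0 u u1 lambda0 _ C hlambda0 CH0 C0 u_gt0 du u1B harnack u_op ulim.
exists A, B; split => //.
apply: (eqaddo_exp _ _ _ _ e C' X) => // x Xx.
rewrite -uW (_ : _ - _ = expR (- lambda0 * x) * (u x - A * x - B)); last by ring.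
by rewrite normrM ger0_norm ?expR_ge0// mulrC ler_pM2r ?expR_gt0// uAB.
Qed.
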